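(* Let $R=\bigoplus_{\alpha\in\Gamma}R_{\alpha}$ be a graded integral domain. Then the following are equivalent: (1) $R$ is integrally closed; (2) $(A_fA_g)^v=A_{fg}^v$ for all $f,g\in R[X]\setminus\{0\}$; (3) there is a (semi)star operation $\star$ on $R$ such that $(A_fA_g)^{\star}=A_{fg}^{\star}$ for all nonzero $f,g\in R_H[X]$ with $f$ linear; (4) $fR_H[X]\cap R[X]=f(R:A_f)R[X]$ for all nonzero $f\in R[X]$.
   Context: $\Gamma$ is a commutative cancellative monoid (written additively) whose quotient group $\langle\Gamma\rangle$ is torsion-free. A graded integral domain $R=\bigoplus_{\alpha\in\Gamma}R_\alpha$ is an integral domain that is the direct sum of additive subgroups $R_\alpha$ with $R_\alpha R_\beta\subseteq R_{\alpha+\beta}$. $K$ is its quotient field, $H$ the set of nonzero homogeneous elements, $R_H$ the homogeneous quotient field. For $a\in R_H$, $C(a)$ is the $R$-submodule of $R_H$ generated by the homogeneous components of $a$; for $f=f_0+\cdots+f_nX^n\in R_H[X]$, $A_f:=\sum_i C(f_i)$. $(R:E)=\{x\in K: xE\subseteq R\}$ and $E^v=(R:(R:E))$. A semistar operation on $R$ is a map $\star$ from the set of nonzero $R$-submodules of $K$ to itself such that for all $0\ne x\in K$ and $E,F$: $(xE)^\star=xE^\star$; $E\subseteq F\Rightarrow E^\star\subseteq F^\star$; $E\subseteq E^\star$; $(E^\star)^\star=E^\star$; it is a (semi)star operation if moreover $R^\star=R$. ''Linear'' means of degree one in $X$. *)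

(* Defs.v *)
From HB Require Import structures.
From mathcomp Require Import all_boot all_order all_algebra.
From mathcomp Require Import boolp classical_sets.
Set Implicit Arguments. Unset Strict Implicit. Unset Printing Implicit Defensive.
Import Order.TTheory GRing.Theory Num.Theory.
Local Open Scope ring_scope.
Local Open Scope classical_set_scope.

Section GradedDefs.
Variables (K : fieldType) (G : zmodType).

(* Gam is a commutative cancellative monoid (a submonoid of the abelian group G)
   whose quotient group (a subgroup of G) is torsion-free. *)
Definition torsion_free_monoid (Gam : set G) : Prop :=
  Gam 0 /\ (forall a b, Gam a -> Gam b -> Gam (a + b)) /\
  (forall (n : nat) (x : G), (0 < n)%N -> x *+ n = 0 -> x = 0).

Definition domain_with_quotient_field (R : set K) : Prop :=
  R 1 /\ (forall x y, R x -> R y -> R (x - y)) /\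
  (forall x y, R x -> R y -> R (x * y)) /\
  (forall x : K, exists a b, R a /\ R b /\ b != 0 /\ x = a / b).

Definition graded_domain (Gam : set G) (R : set K) (Rg : G -> set K) : Prop :=
  torsion_free_monoid Gam /\ domain_with_quotient_field R /\
  (forall a, ~ Gam a -> Rg a `<=` [set 0]) /\
  (forall a, Rg a `<=` R) /\
  (forall a, Rg a 0 /\ forall x y, Rg a x -> Rg a y -> Rg a (x - y)) /\
  (forall a b x y, Rg a x -> Rg b y -> Rg (a + b) (x * y)) /\
  (forall r, R r -> exists (s : seq G) (c : G -> K),
      (forall a, Rg a (c a)) /\ r = \sum_(a <- s) c a) /\
  (forall (s : seq G) (c : G -> K), uniq s -> (forall a, Rg a (c a)) ->
      \sum_(a <- s) c a = 0 -> forall a, a \in s -> c a = 0).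

Variables (R : set K) (Rg : G -> set K).

Definition homog : set K := [set x | x != 0 /\ exists a, Rg a x].

Definition RH : set K := [set x | exists a h, R a /\ homog h /\ x = a / h].

(* y is a homogeneous component of x in R_H (x = r/h, y = r_alpha/h) *)
Definition hcomp (x : K) : set K :=
  [set y | exists (r h : K) (s : seq G) (c : G -> K),
     homog h /\ x = r / h /\ (forall a, Rg a (c a)) /\ uniq s /\
     r = \sum_(a <- s) c a /\ exists2 a, a \in s & y = c a / h].

Definition span (S : set K) : set K :=
  [set z | exists (n : nat) (r e : 'I_n -> K),
     (forall i, R (r i)) /\ (forall i, S (e i)) /\ z = \sum_(i < n) r i * e i].

Definition Cmod (x : K) : set K := span (hcomp x).

Definition Apoly (f : {poly K}) : set K :=
  [set z | exists e : 'I_(size f) -> K,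
     (forall i : 'I_(size f), Cmod f`_i (e i)) /\ z = \sum_(i < size f) e i].

Definition modmul (A B : set K) : set K :=
  span [set z | exists a b, A a /\ B b /\ z = a * b].

Definition colon (E : set K) : set K := [set x | forall e, E e -> R (x * e)].
Definition vop (E : set K) : set K := colon (colon E).

Definition scale (x : K) (E : set K) : set K := [set z | exists2 e, E e & z = x * e].

Definition nonzero_submodule (E : set K) : Prop :=
  E 0 /\ (forall x y, E x -> E y -> E (x + y)) /\
  (forall r x, R r -> E x -> E (r * x)) /\ exists x, E x /\ x != 0.

Definition semistar (star : set K -> set K) : Prop :=
  (forall E, nonzero_submodule E -> nonzero_submodule (star E)) /\
  (forall x E, x != 0 -> nonzero_submodule E -> star (scale x E) = scale x (star E)) /\
  (forall E F, nonzero_submodule E -> nonzero_submodule F -> E `<=` F ->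
      star E `<=` star F) /\
  (forall E, nonzero_submodule E -> E `<=` star E) /\
  (forall E, nonzero_submodule E -> star (star E) = star E).

Definition coefs_in (S : set K) (p : {poly K}) : Prop := forall i, S p`_i.

Definition integrally_closed : Prop :=
  forall x : K, (exists p : {poly K}, p \is monic /\ coefs_in R p /\ root p x) -> R x.

End GradedDefs.

(* Main.v *)
Require Import Defs.
From HB Require Import structures.
From mathcomp Require Import all_boot all_order all_algebra zify ring.
From mathcomp Require Import boolp classical_sets.
Import Order.TTheory GRing.Theory Num.Theory.
Local Open Scope ring_scope.
Local Open Scope classical_set_scope.

(* Torsion-freeness makes the group of degrees a unique-sum group: any two finite nonempty
   sets of degrees have a sum attained only once. Northcott's induction then gives the
   Dedekind-Mertens inclusion A_f^(N+1) A_g <= A_f^N A_(fg) for large N, with f and g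
   regarded as elements graded by G * nat. If x A_(fg) <= R, then x A_f A_g stabilises the
   finitely generated module A_f^N, so x A_f A_g <= R when R is integrally closed; this
   yields (2), (3) (with the v-operation) and (4).

   Conversely let x be integral over R. The ring R_H is integrally closed: a finitely
   generated group of degrees is free, so finitely many elements of R_H lie in a Laurent
   polynomial ring over the field (R_H)_0, and complete integral closedness passes from S
   to S[u]. Hence x is in R_H, and X - x divides a monic polynomial over R with quotient
   in R_H[X]; comparing contents in (2), (3) or (4) gives that x is in R. *)

(* [vector.span] shadows the span of the definitions. *)
Local Notation span := Defs.span.

(** * Subrings of a field, spans, and integrality from a stable finitely generated module *)

Section Subrings.
Set Implicit Arguments.
Unset Strict Implicit.
Variable K : fieldType.

(** With terms indexed by pairs (degree, exponent), [A_f] is spanned by the terms of [f], and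
    [A_(fg)] by the sums of products over equal total index. Dedekind-Mertens thus becomes a
    statement about two finite families, and unique sums are all it asks of the index monoid: no
    order on the whole group has to be chosen. It is applied over [R_H], as (3) demands, not only
    over [R].

    For [R_H], the complete form of integral closedness is the one carried up the tower because it
    can be tested on one leading coefficient at a time; mere integrality would require control over
    all coefficients of an integral polynomial. The bottom of the tower is a field, where nothing is
    to be proved. The tower is built from polynomial rings, so negative exponents are first cleared
    by a power of a homogeneous unit, and the integral equation is rescaled accordingly.

    In (2) and (4) the factor [X - x] must first be brought into [R[X]]; the multiplier is taken
    homogeneous, so that it factors out of contents. *)

Definition subring (S : set K) : Prop :=
  [/\ S 1, forall x y, S x -> S y -> S (x - y) & forall x y, S x -> S y -> S (x * y)].

Definition submodule (S M : set K) : Prop :=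
  [/\ M 0, forall x y, M x -> M y -> M (x + y) & forall r x, S r -> M x -> M (r * x)].

Variables (S : set K) (sS : subring S).

Lemma subring1 : S 1. Proof. by case: sS. Qed.
Lemma subringB x y : S x -> S y -> S (x - y). Proof. by case: sS => _ + _; apply. Qed.
Lemma subringM x y : S x -> S y -> S (x * y). Proof. by case: sS => _ _; apply. Qed.
Lemma subring0 : S 0.
Proof. by rewrite -(subrr 1); apply: subringB; apply: subring1. Qed.
Lemma subringN x : S x -> S (- x).
Proof. by rewrite -sub0r; apply: subringB; apply: subring0. Qed.
Lemma subringD x y : S x -> S y -> S (x + y).
Proof. by move=> Sx Sy; rewrite -[y]opprK; apply: subringB => //; apply: subringN. Qed.
Lemma subringX x n : S x -> S (x ^+ n).
Proof.
by move=> Sx; elim: n => [|n IHn]; rewrite ?exprS; [apply: subring1 | apply: subringM].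
Qed.
Lemma subringMn x n : S x -> S (x *+ n).
Proof.
by move=> Sx; elim: n => [|n IHn]; rewrite ?mulrS; [apply: subring0 | apply: subringD].
Qed.
Lemma subring_sum (I : eqType) (r : seq I) (P : pred I) (F : I -> K) :
  (forall i, i \in r -> P i -> S (F i)) -> S (\sum_(i <- r | P i) F i).
Proof.
move=> SF; rewrite big_seq_cond; apply: big_ind => [||i /andP[]]; last exact: SF.
  exact: subring0.
exact: subringD.
Qed.

Lemma submodule_subring : submodule S S.
Proof. by split; [apply: subring0 | apply: subringD | apply: subringM]. Qed.

Lemma submodule_sum (M : set K) (I : Type) (r : seq I) (P : pred I) (F : I -> K) :
  submodule S M -> (forall i, P i -> M (F i)) -> M (\sum_(i <- r | P i) F i).
Proof. by case=> M0 MD _ MF; apply: big_ind. Qed.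

Lemma span_gen (A : set K) x : A x -> span S A x.
Proof.
move=> Ax; exists 1%N, (fun=> 1), (fun=> x); split=> [_|]; first exact: subring1.
by rewrite big_ord1 mul1r.
Qed.

Lemma submodule_span (A : set K) : submodule S (span S A).
Proof.
split.
- exists 0%N, (fun=> 0), (fun=> 0); rewrite big_ord0; split=> [[]|] //.
  by split=> [[]|].
- move=> _ _ [n [r [e [Sr [Ae ->]]]]] [m [r' [e' [Sr' [Ae' ->]]]]].
  pose sel T (u : 'I_n -> T) (v : 'I_m -> T) (i : 'I_(n + m)) :=
    match split i with inl i => u i | inr i => v i end.
  exists (n + m)%N, (sel _ r r'), (sel _ e e').
  rewrite /sel; split=> [i|]; first by case: split.
  split=> [i|]; first by case: split.
  rewrite big_split_ord; congr (_ + _); apply: eq_bigr => i _.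
    by rewrite -/(lshift m i) -[lshift m i]/(unsplit (inl i)) unsplitK.
  by rewrite -[rshift n i]/(unsplit (inr i)) unsplitK.
- move=> a _ Sa [n [r [e [Sr [Ae ->]]]]]; exists n, (fun i => a * r i), e.
  split=> [i|]; first exact: subringM.
  by split=> //; rewrite mulr_sumr; apply: eq_bigr => i _; rewrite mulrA.
Qed.

Lemma span_min (A M : set K) : submodule S M -> A `<=` M -> span S A `<=` M.
Proof.
move=> sM AM _ [n [r [e [Sr [Ae ->]]]]]; apply: submodule_sum => // i _.
by case: sM => _ _; apply=> //; apply: AM.
Qed.

Lemma span_eq (A B : set K) :
  A `<=` span S B -> B `<=` span S A -> span S A = span S B.
Proof.
by move=> AB BA; apply/seteqP; split; apply: span_min => //; apply: submodule_span.
Qed.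

Lemma submodule_preim (M : set K) (x : K) :
  submodule S M -> submodule S [set y | M (x * y)].
Proof.
case=> M0 MD MZ; split=> /= [|y z My Mz|r y Sr My]; rewrite ?mulr0 ?mulrDr //.
  exact: MD.
by rewrite mulrCA; apply: MZ.
Qed.

Lemma modmul_gen (A B : set K) a b : A a -> B b -> modmul S A B (a * b).
Proof. by move=> Aa Bb; apply: span_gen; exists a, b. Qed.

(** Indexing the coefficients by positions in [L], rather than by elements, lets them fill a square
    matrix even if [L] has repetitions. *)
Lemma span_seqP (L : seq K) x : span S [set y | y \in L] x ->
  exists2 c : 'I_(size L) -> K, forall j, S (c j) & x = \sum_j c j * L`_j.
Proof.
set M := [set x | exists2 c : 'I_(size L) -> K, forall j, S (c j) & x = \sum_j c j * L`_j].
suff: span S [set y | y \in L] `<=` M by apply.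
apply: span_min.
  split.
  - exists (fun=> 0) => [_|]; first exact: subring0.
    by rewrite big1 // => i _; rewrite mul0r.
  - move=> _ _ [c Sc ->] [c' Sc' ->]; exists (fun j => c j + c' j) => [j|].
      exact: subringD.
    by rewrite -big_split; apply: eq_bigr => j _; rewrite mulrDl.
  - move=> r _ Sr [c Sc ->]; exists (fun j => r * c j) => [j|]; first exact: subringM.
    by rewrite mulr_sumr; apply: eq_bigr => j _; rewrite mulrA.
move=> y /= yL; have iL : (index y L < size L)%N by rewrite index_mem.
exists (fun j => (j == Ordinal iL)%:R) => [j|].
  by case: (_ == _); [apply: subring1 | apply: subring0].
rewrite (bigD1 (Ordinal iL)) //= eqxx mul1r nth_index // big1 ?addr0 //.
by move=> j /negPf ->; rewrite mul0r.
Qed.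

Lemma coefs_inC c : S c -> coefs_in S c%:P.
Proof. by move=> Sc i; rewrite coefC; case: ifP => // _; apply: subring0. Qed.
Lemma coefs_inXn n : coefs_in S 'X^n.
Proof. by move=> i; rewrite coefXn; case: eqP => _; [apply: subring1 | apply: subring0]. Qed.
Lemma coefs_inX : coefs_in S 'X.
Proof. exact: (coefs_inXn 1). Qed.
Lemma coefs_inB p q : coefs_in S p -> coefs_in S q -> coefs_in S (p - q).
Proof. by move=> Sp Sq i; rewrite coefB; apply: subringB. Qed.
Lemma coefs_inD p q : coefs_in S p -> coefs_in S q -> coefs_in S (p + q).
Proof. by move=> Sp Sq i; rewrite coefD; apply: subringD. Qed.
Lemma coefs_inM p q : coefs_in S p -> coefs_in S q -> coefs_in S (p * q).
Proof.
move=> Sp Sq i; rewrite coefM; apply: subring_sum => j _ _; exact: subringM.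
Qed.
Lemma coefs_inZ c p : S c -> coefs_in S p -> coefs_in S (c *: p).
Proof. by move=> Sc Sp i; rewrite coefZ; apply: subringM. Qed.
Lemma coefs_inXe p n : coefs_in S p -> coefs_in S (p ^+ n).
Proof.
move=> Sp; elim: n => [|n IHn]; last by rewrite exprS; apply: coefs_inM.
exact: coefs_inC subring1.
Qed.

Lemma coefs_in_char_poly n (A : 'M[K]_n) :
  (forall i j, S (A i j)) -> coefs_in S (char_poly A).
Proof.
move=> SA; rewrite /char_poly /determinant.
apply: (big_ind (coefs_in S)) => [||s _].
- by apply: coefs_inC; apply: subring0.
- exact: coefs_inD.
- apply: coefs_inM.
    rewrite -(rmorph_sign polyC); apply: coefs_inC; apply: subringX.
    by apply: subringN; apply: subring1.
  apply: (big_ind (coefs_in S)) => [||i _]; [|exact: coefs_inM|].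
    exact: coefs_inC subring1.
  rewrite !mxE; apply: coefs_inB; last exact: coefs_inC.
  by case: (_ == _); [apply: coefs_inX | apply: coefs_inC subring0].
Qed.

(* Cayley-Hamilton in disguise: z is an eigenvalue of a matrix over S. *)
Lemma integral_of_stable (L : seq K) (z y0 : K) : y0 \in L -> y0 != 0 ->
  (forall y, y \in L -> span S [set y | y \in L] (z * y)) ->
  exists p : {poly K}, p \is monic /\ coefs_in S p /\ root p z.
Proof.
move=> y0L y0n0 zL; pose n := size L.
have /choice[c Hc] : forall i : 'I_n, exists c : 'I_n -> K,
    (forall j, S (c j)) /\ z * L`_i = \sum_j c j * L`_j.
  move=> i; have /zL/span_seqP[c Sc e] : L`_i \in L by apply: mem_nth.
  by exists c.
(* The matrix is transposed because eigenvectors are rows acting from the left; the row of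
   generators is the eigenvector, nonzero thanks to [y0]. *)
exists (char_poly (\matrix_(i, j) c j i)); split; first exact: char_poly_monic.
split; first by apply: coefs_in_char_poly => i j; rewrite mxE; case: (Hc j).
rewrite -eigenvalue_root_char; apply/eigenvalueP.
exists (\row_j L`_j).
  apply/rowP=> i; rewrite !mxE; case: (Hc i) => _ ->.
  by apply: eq_bigr => j _; rewrite !mxE mulrC.
apply/eqP=> /rowP /(_ (Ordinal (_ : index y0 L < n)%N)) H.
have iL : (index y0 L < n)%N by rewrite index_mem.
by move: (H iL); rewrite !mxE /= nth_index //; apply/eqP.
Qed.

End Subrings.

(** * Unique sums in torsion-free abelian groups *)

Section UniqueSums.
Set Implicit Arguments.
Unset Strict Implicit.

Definition torsion_free (G : zmodType) : Prop :=
  forall (n : nat) (x : G), (0 < n)%N -> x *+ n = 0 -> x = 0.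

Definition unique_sums (D : nmodType) : Prop :=
  forall s t : seq D, s != [::] -> t != [::] ->
  exists2 a, a \in s & exists2 b, b \in t &
    forall a' b', a' \in s -> b' \in t -> a' + b' = a + b -> a' = a /\ b' = b.

(** The set of nonnegative elements of a translation-invariant partial order on [G]. *)
Definition positive_cone (G : zmodType) (P : set G) : Prop :=
  [/\ P 0, forall x y, P x -> P y -> P (x + y) & forall x, P x -> P (- x) -> x = 0].

Lemma positive_coneMn (G : zmodType) (P : set G) x n :
  positive_cone P -> P x -> P (x *+ n).
Proof. by case=> P0 PD _ Px; elim: n => // n IHn; rewrite mulrS; apply: PD. Qed.

(** If [z = p + n x] and [- z = q + m x], then [p + q = - (n + m) x]. So antisymmetry can only fail
    when a positive multiple of [- x] was already in the cone, which the hypothesis confines to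
    [x = 0]. *)
Lemma positive_cone_extend (G : zmodType) (P : set G) x :
  positive_cone P -> (forall n, (0 < n)%N -> P (- x *+ n) -> x = 0) ->
  positive_cone [set z | exists2 p, P p & exists n, z = p + x *+ n].
Proof.
case=> P0 PD PN Px; split=> [|_ _ [p Pp [n ->]] [q Pq [m ->]]|z [p Pp [n zp]] [q Pq [m zq]]].
- by exists 0 => //; exists 0; rewrite addr0.
- by exists (p + q); [apply: PD | exists (n + m)%N; rewrite mulrnDr addrACA].
have pq : p + q = - x *+ (n + m).
  apply/eqP; rewrite mulNrn -addr_eq0 mulrnDr addrACA -zp -zq.
  by rewrite subrr.
have [nm|nm] := posnP (n + m).
  move/eqP: nm; rewrite addn_eq0 => /andP[/eqP n0 /eqP m0].
  move: pq zp zq; rewrite n0 m0 !mulr0n !addr0 => pq -> e.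
  by apply: PN => //; rewrite -[- p]add0r -pq addrAC subrr add0r.
have x0 : x = 0 by apply: (Px _ nm); rewrite -pq; apply: PD.
move: pq zp; rewrite x0 oppr0 !mul0rn addr0 => pq ->.
by apply: PN => //; rewrite -[- p]add0r -pq addrAC subrr add0r.
Qed.

Lemma positive_cone_total (G : zmodType) (s : seq G) : torsion_free G ->
  exists2 P, positive_cone P & forall x, x \in s -> P x \/ P (- x).
Proof.
move=> tfG; elim: s => [|x s [P coneP Ps]].
  exists [set 0] => //; split=> // x y -> ->; exact: addr0.
have [P0 PD PN] := coneP.
(* If a positive multiple of [- x] is already nonnegative, [- x] must be adjoined. This is safe:
   were [m x] nonnegative too, [n m x] and its opposite would both be, so [n m x = 0] and [x = 0] by
   torsion-freeness. Otherwise [x] can be adjoined. *)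
have [[n n0 Pn]|noP] := pselect (exists2 n, (0 < n)%N & P (- x *+ n)).
- exists [set z | exists2 p, P p & exists n, z = p + (- x) *+ n].
    apply: positive_cone_extend => // m m0 Pm.
    apply/eqP; rewrite oppr_eq0; apply/eqP.
    have nm0 : (0 < n * m)%N by rewrite muln_gt0 n0 m0.
    apply: (tfG (n * m)%N) => //; apply: PN.
      rewrite mulnC mulrnA; move: Pm; rewrite opprK => /(positive_coneMn n coneP) //.
    by rewrite -mulNrn mulrnA; apply: positive_coneMn.
  move=> y; rewrite inE => /orP[/eqP ->|/Ps[Py|Py]].
  + by right; exists 0 => //; exists 1%N; rewrite add0r.
  + by left; exists y => //; exists 0%N; rewrite addr0.
  + by right; exists (- y) => //; exists 0%N; rewrite addr0.
- exists [set z | exists2 p, P p & exists n, z = p + x *+ n].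
    by apply: positive_cone_extend => // n n0 Pn; case: noP; exists n.
  move=> y; rewrite inE => /orP[/eqP ->|/Ps[Py|Py]].
  + by left; exists 0 => //; exists 1%N; rewrite add0r.
  + by left; exists y => //; exists 0%N; rewrite addr0.
  + by right; exists (- y) => //; exists 0%N; rewrite addr0.
Qed.

Lemma seq_maximum (G : zmodType) (P : set G) (s : seq G) :
  positive_cone P -> s != [::] ->
  (forall x y, x \in s -> y \in s -> P (x - y) \/ P (y - x)) ->
  exists2 a, a \in s & forall x, x \in s -> P (a - x).
Proof.
case=> P0 PD _; elim: s => // x [|y s] IHs _ tot.
  by exists x; rewrite ?mem_head // => z; rewrite inE => /eqP ->; rewrite subrr.
case: IHs => // [u v us vs|a as_ Pa].
  by apply: tot; rewrite inE ?us ?vs orbT.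
have as' : a \in [:: x, y & s] by rewrite inE as_ orbT.
have [ax|xa] := tot a x as' (mem_head _ _).
  by exists a => // z; rewrite inE => /orP[/eqP ->|/Pa].
exists x; first exact: mem_head.
move=> z; rewrite inE => /orP[/eqP ->|/Pa az]; first by rewrite subrr.
by rewrite -[x](subrK a) -addrA; apply: PD.
Qed.

(* A torsion-free abelian group is orderable; on finitely many elements the order is
   reached by adding them one at a time to a positive cone. *)
Lemma unique_sums_torsion_free (G : zmodType) : torsion_free G -> unique_sums G.
Proof.
move=> tfG s t s0 t0.
pose diffs (u : seq G) := [seq x - y | x <- u, y <- u].
have [P coneP Ptot] := positive_cone_total (diffs s ++ diffs t) tfG.
have tot u : {subset diffs u <= diffs s ++ diffs t} ->
    forall x y, x \in u -> y \in u -> P (x - y) \/ P (y - x).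
  move=> sub x y xu yu; rewrite -[y - x]opprB; apply: Ptot; apply: sub.
  exact: (allpairs_f (fun x y => x - y)).
have [a as_ Pa] : exists2 a, a \in s & forall x, x \in s -> P (a - x).
  by apply: seq_maximum => //; apply: tot => x; rewrite mem_cat => ->.
have [b bt Pb] : exists2 a, a \in t & forall x, x \in t -> P (a - x).
  by apply: seq_maximum => //; apply: tot => x; rewrite mem_cat orbC => ->.
exists a => //; exists b => // a' b' /Pa Paa /Pb Pbb e.
have ab : a - a' = - (b - b').
  by apply/eqP; rewrite -addr_eq0 addrACA -opprD e subrr.
have [_ _ PN] := coneP.
have /eqP : b - b' = 0 by apply: PN; rewrite -?ab.
rewrite subr_eq0 => /eqP bb; split=> //.
by apply/eqP; rewrite eq_sym -subr_eq0 ab bb subrr oppr0.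
Qed.

Lemma unique_sums_inj (D E : nmodType) (phi : D -> E) : injective phi ->
  {morph phi : x y / x + y} -> unique_sums E -> unique_sums D.
Proof.
move=> phiI phiD uE s t s0 t0.
have ne (u : seq D) : u != [::] -> map phi u != [::] by case: u.
have [_ /mapP[a as_ ->] [_ /mapP[b bt ->] H]] := uE _ _ (ne _ s0) (ne _ t0).
exists a => //; exists b => // a' b' a's b't e.
have [] := H (phi a') (phi b'); rewrite ?map_f //; first by rewrite -!phiD e.
by move=> /phiI -> /phiI ->.
Qed.

Lemma torsion_free_int_prod (G : zmodType) :
  torsion_free G -> torsion_free (G * int)%type.
Proof.
move=> tfG n x n0 xn.
have E m : (x *+ m = (x.1 *+ m, x.2 *+ m)) by elim: m => // m IHm; rewrite !mulrS IHm.
move: xn; rewrite E => -[/(tfG _ _ n0) x1 /eqP].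
by rewrite mulrn_eq0 -leqn0 leqNgt n0 /= => /eqP x2; rewrite [x]surjective_pairing x1 x2.
Qed.

(** Exponents of [X] form only a monoid; it is embedded in [int] to stay within torsion-free
    groups. *)
Lemma unique_sums_nat_prod (G : zmodType) :
  torsion_free G -> unique_sums (G * nat)%type.
Proof.
move=> tfG.
apply: (@unique_sums_inj _ (G * int)%type (fun d => (d.1, d.2%:Z))).
- by move=> [x m] [y n] /= [-> ->].
- by move=> [x m] [y n] /=; congr (_, _); rewrite PoszD.
- by apply: unique_sums_torsion_free; apply: torsion_free_int_prod.
Qed.

End UniqueSums.

(** * The Dedekind-Mertens inclusion for two finite families *)

Section DedekindMertens.
Set Implicit Arguments.
Unset Strict Implicit.
Variables (K : fieldType) (S : set K) (sS : subring S).
Variables (D : nmodType) (uD : unique_sums D) (F G : D -> K).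

(** The component of index [g] in the product of the two families cut down to [s] and [t]. Keeping
    [s] and [t] as parameters lets the induction delete single terms. *)
Definition convolution (s t : seq D) (g : D) : K :=
  \sum_(d <- s) \sum_(e <- t | d + e == g) F d * G e.

(** Generators of the [n]-th power of the module spanned by the [F d], kept as a list since the
    integrality criterion wants a finite family. *)
Fixpoint monomials (s : seq D) (n : nat) : seq K :=
  if n is n'.+1 then [seq F d * y | d <- s, y <- monomials s n'] else [:: 1].

Lemma monomialsS s n d y : d \in s -> y \in monomials s n -> F d * y \in monomials s n.+1.
Proof. by move=> ds ys; apply: allpairs_f. Qed.

Lemma monomialsP s n y : y \in monomials s n.+1 ->
  exists d z, [/\ d \in s, z \in monomials s n & y = F d * z].
Proof. by case/allpairsP=> -[d z] [ds zs ->]; exists d, z. Qed.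

Lemma monomials_sub (s s' : seq D) n :
  {subset s <= s'} -> {subset monomials s n <= monomials s' n}.
Proof.
move=> ss'; elim: n => // n IHn _ /monomialsP[d [y [ds ys ->]]].
by apply: monomialsS; [apply: ss' | apply: IHn].
Qed.

Lemma monomials_rem (s : seq D) n d y : uniq s -> y \in monomials s n.+1 ->
  y \in monomials (rem d s) n.+1 \/ exists2 z, z \in monomials s n & y = F d * z.
Proof.
move=> us; elim: n y => [|n IHn] y /monomialsP[d' [z [d's zs ->]]].
  have [->|d'd] := eqVneq d' d; first by right; exists z.
  by left; apply: monomialsS => //; rewrite mem_rem_uniq // inE d'd.
have [->|d'd] := eqVneq d' d; first by right; exists z.
have [zs'|[w ws ->]] := IHn _ zs; last first.
  by right; exists (F d' * w); [apply: monomialsS | rewrite mulrCA].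
by left; apply: monomialsS => //; rewrite mem_rem_uniq // inE d'd.
Qed.

Lemma convolution_reml s t d g : d \in s ->
  convolution (rem d s) t g = convolution s t g - \sum_(e <- t | d + e == g) F d * G e.
Proof.
move=> ds; rewrite /convolution (perm_big _ (perm_to_rem ds)) big_cons.
by rewrite [RHS]addrC addKr.
Qed.

Lemma convolution_remr s t e g : e \in t ->
  convolution s (rem e t) g = convolution s t g - \sum_(d <- s | d + e == g) F d * G e.
Proof.
move=> et; rewrite /convolution.
under [X in _ = X - _]eq_bigr => d _.
  rewrite (perm_big _ (perm_to_rem et)) big_cons /=.
  rewrite (_ : (if _ then _ else _) = (if d + e == g then F d * G e else 0)
    + \sum_(j <- rem e t | d + j == g) F d * G j); last by case: ifP; rewrite ?add0r.
  over.
by rewrite big_split -big_mkcond /= [RHS]addrC addKr.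
Qed.

(** This is [A_f^n A_(fg)], for [f] and [g] restricted to [s] and [t]. *)
Definition mixed (s t : seq D) (n : nat) : set K :=
  span S [set z | exists y g, y \in monomials s n /\ z = y * convolution s t g].

(* Northcott's induction: peel off one term of either factor, chosen so that the product
   of the two terms is a whole component of the product. *)
Lemma dedekind_mertens n s t : uniq s -> uniq t -> (size s + size t <= n)%N ->
  forall y e, y \in monomials s n.+1 -> e \in t -> mixed s t n (y * G e).
Proof.
have [k] := ubnP (size s + size t + n); elim: k n s t => // k IHk n s t kb us ut nb y e ys et.
have s0 : s != [::] by case: (s) ys.
have t0 : t != [::] by case: (t) et.
have [d0 d0s [e0 e0t uniqde]] := uD s0 t0.
have n0 : (0 < n)%N by apply: leq_trans nb; case: (s) s0.
case: n n0 kb nb ys => // n _ kb nb ys.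
have conv0 : convolution s t (d0 + e0) = F d0 * G e0.
  rewrite /convolution (bigD1_seq d0) //= big_mkcond (bigD1_seq e0) //= eqxx.
  rewrite big1_seq => [|e' /andP[e'e0 e't]]; last first.
    by case: eqP => // /(uniqde _ _ d0s e't)[_ ee]; rewrite ee eqxx in e'e0.
  rewrite addr0 big1_seq ?addr0 // => d' /andP[d'd d's].
  rewrite big_seq_cond big1 // => e' /andP[e't /eqP de].
  by case: (uniqde _ _ d's e't de) => d'd0; rewrite d'd0 eqxx in d'd.
have sub m : submodule S (mixed s t m) := submodule_span sS _.
have [M0 MD MZ] := sub n.+1.
have MN x : mixed s t n.+1 x -> mixed s t n.+1 (- x).
  by move=> Mx; rewrite -mulN1r; apply: MZ => //; apply: (subringN sS); apply: subring1.
have Mconv z g : z \in monomials s n.+1 -> mixed s t n.+1 (z * convolution s t g).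
  by move=> zs; apply: (span_gen sS); exists z, g.
have Mtop z : z \in monomials s n.+1 -> mixed s t n.+1 (z * (F d0 * G e0)).
  by move=> zs; rewrite -conv0; apply: Mconv.
have IHt z e' : z \in monomials s n.+1 -> e' \in t -> e' != e0 ->
    mixed s (rem e0 t) n (z * G e').
  move=> zs e't e'e0; have t1 : (0 < size t)%N by rewrite lt0n size_eq0.
  apply: IHk; rewrite ?rem_uniq ?size_rem ?mem_rem_uniq ?inE ?e'e0 //; move: kb nb t1; clear; lia.
(* For [e' != e0] the induction applies with [e0] deleted from [t]. Restoring [e0] in the
   convolutions costs error terms, each a monomial times [F d' * G e0]; [H] assumes that they are
   harmless. *)
have step z d' e' : z \in monomials s n.+1 -> d' \in s -> e' \in t -> e' != e0 ->
    (forall w d, w \in monomials s n -> d \in s ->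
       mixed s t n.+1 (F d * w * (F d' * G e0))) ->
    mixed s t n.+1 (F d' * (z * G e')).
  move=> zs d's e't e'e0 H.
  have := IHt _ _ zs e't e'e0; apply: (span_min (submodule_preim _ (sub n.+1))).
  move=> _ [w [g [ws ->]]] /=; rewrite convolution_remr // mulrA mulrBr.
  apply: MD; first by apply: Mconv; apply: monomialsS.
  apply: MN; rewrite mulr_sumr big_seq_cond; apply: submodule_sum => // d /andP[ds _].
  by rewrite -mulrA mulrCA [F d' * _]mulrCA mulrA [w * F d]mulrC; apply: H.
(* A monomial containing [F d0] meets [G e0] in a whole component. Any other survives the deletion
   of [d0] from [s]; restoring [d0] yields error terms with a factor [F d0], absorbed by [Mtop]
   directly if [e' = e0] and through [step] otherwise. *)
have low z : z \in monomials s n.+2 -> mixed s t n.+1 (z * G e0).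
  move=> /(monomials_rem d0 us)[zs|[w ws ->]]; last first.
    by rewrite mulrAC mulrC; apply: Mtop.
  have : mixed (rem d0 s) t n.+1 (z * G e0).
    have s1 : (0 < size s)%N by rewrite lt0n size_eq0.
    by apply: IHk; rewrite ?rem_uniq ?size_rem //; move: kb nb s1; clear; lia.
  apply: (span_min (sub n.+1)) => _ [w [g [ws ->]]].
  have {}ws : w \in monomials s n.+1 by apply: monomials_sub ws => x /mem_rem.
  rewrite convolution_reml // mulrBr; apply: MD; first exact: Mconv.
  apply: MN; rewrite mulr_sumr big_seq_cond; apply: submodule_sum => // e' /andP[e't _].
  have [->|e'e0] := eqVneq e' e0; first exact: Mtop.
  by rewrite mulrCA; apply: step => // w' d ws' ds; apply/Mtop/monomialsS.
(* For [e != e0], the error terms of [step] are monomials of degree [n.+2] times [G e0], which is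
   the case [low]. *)
have [->|ee0] := eqVneq e e0; first exact: low.
move: ys => /monomialsP[d [z [ds zs ->]]]; rewrite -mulrA.
apply: step => // w d' ws d's; rewrite mulrA.
by apply: low; rewrite mulrC; apply: monomialsS => //; apply: monomialsS.
Qed.

Lemma monomialsX s n d : d \in s -> F d ^+ n \in monomials s n.
Proof.
move=> ds; elim: n => [|n IHn]; first by rewrite inE.
by rewrite exprS; apply: monomialsS.
Qed.

(** Multiplication by [x F d G e] sends [A_f^n] into [x A_f^n A_(fg)], hence into itself. The
    nonzero term [F d0] supplies the nonzero generator that the eigenvalue argument requires. *)
Lemma convolution_integral s t d0 (x : K) : integrally_closed S ->
  uniq s -> uniq t -> d0 \in s -> F d0 != 0 ->
  (forall g, S (x * convolution s t g)) ->
  forall d e, d \in s -> e \in t -> S (x * (F d * G e)).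
Proof.
move=> icS us ut d0s Fd0 xC d e ds et; apply: icS.
(* The least exponent that [dedekind_mertens] admits. *)
pose n := (size s + size t)%N.
apply: (@integral_of_stable _ _ sS (monomials s n) _ (F d0 ^+ n)).
- exact: monomialsX.
- by rewrite expf_eq0 (negPf Fd0) andbF.
move=> y yL; rewrite -mulrA -(mulrAC _ y).
have := dedekind_mertens us ut (leqnn _) (monomialsS ds yL) et.
have sL := submodule_span sS [set y | y \in monomials s n].
apply: (span_min (submodule_preim x sL)) => _ [w [g [ws ->]]] /=.
rewrite mulrCA mulrC; case: sL => _ _; apply; first exact: xC.
exact: (span_gen sS).
Qed.

End DedekindMertens.

(** * Complete integral closedness and its passage to [S[u]] *)

Section CompleteIntegralClosure.
Set Implicit Arguments.
Unset Strict Implicit.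
Variables (K : fieldType).

Definition fractions (S : set K) : set K :=
  [set x | exists a b, [/\ S a, S b, b != 0 & x = a / b]].

(** The case [n = 0] already places [d] in [S]. *)
Definition almost_integral (S : set K) (x : K) : Prop :=
  exists2 d, d != 0 & forall n, S (d * x ^+ n).

Definition completely_integrally_closed (S : set K) : Prop :=
  forall x, fractions S x -> almost_integral S x -> S x.

Definition adjoin (S : set K) (u : K) : set K :=
  [set x | exists2 p, coefs_in S p & x = p.[u]].

Definition transcendental (S : set K) (u : K) : Prop :=
  forall p, coefs_in S p -> p.[u] = 0 -> p = 0.

Variables (S : set K) (sS : subring S) (u : K).

Lemma subring_adjoin : subring (adjoin S u).
Proof.
split.
- by exists 1; rewrite ?hornerC //; apply: (coefs_inC sS); apply: (subring1 sS).
- move=> _ _ [p Sp ->] [q Sq ->]; exists (p - q); rewrite ?hornerD ?hornerN //.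
  exact: (coefs_inB sS).
- by move=> _ _ [p Sp ->] [q Sq ->]; exists (p * q); rewrite ?hornerM //; apply: (coefs_inM sS).
Qed.

Lemma adjoin_base : S `<=` adjoin S u.
Proof. by move=> x Sx; exists x%:P; rewrite ?hornerC //; apply: (coefs_inC sS). Qed.

Lemma adjoin_gen : adjoin S u u.
Proof. by exists 'X; rewrite ?hornerX //; apply: (coefs_inX sS). Qed.

(** If [y = A / B] satisfies a monic equation of degree [n], then [B ^+ n] is a common denominator
    of all powers: it clears those below [n], and the equation reduces the higher ones to lower
    ones. *)
Lemma almost_integral_of_integral (y : K) (q : {poly K}) :
  fractions S y -> q \is monic -> coefs_in S q -> root q y ->
  almost_integral S y.
Proof.
move=> [A [B [SA SB B0 yE]]] mq Sq qy; pose n := (size q).-1.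
have sq : size q = n.+1 by rewrite prednK // size_poly_gt0 monic_neq0.
have yn : y ^+ n = - \sum_(i < n) q`_i * y ^+ i.
  have qn : q`_n = 1 := monicP mq.
  apply/eqP; rewrite -addr_eq0 addrC; move: qy; rewrite /root horner_coef sq.
  by rewrite big_ord_recr /= qn mul1r.
exists (B ^+ n); first exact: expf_neq0.
move=> m; have [k] := ubnP m; elim: k m => // k IHk m mk.
have [mn|nm] := ltnP m n.
  have -> : B ^+ n * y ^+ m = B ^+ (n - m) * A ^+ m.
    rewrite yE expr_div_n -{1}(subnK (ltnW mn)) exprD.
    by rewrite -mulrA [B ^+ m * _]mulrC divfK ?expf_neq0.
  by apply: (subringM sS); apply: (subringX sS).
rewrite -(subnK nm) exprD yn mulrN mulrN mulrA mulr_sumr; apply: (subringN sS).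
apply: (subring_sum sS) => i _ _; rewrite mulrCA -mulrA -exprD.
apply: (subringM sS) => //; apply: IHk.
apply: leq_trans (_ : m <= _)%N; last by [].
by rewrite -{2}(subnK nm) ltn_add2l.
Qed.

(** The leading coefficient of [b] need not be invertible in [S], so each division step first
    multiplies by it; [s] collects these factors. *)
Lemma pseudo_division (a b : {poly K}) : coefs_in S a -> coefs_in S b -> b != 0 ->
  exists s q r, [/\ S s, s != 0, coefs_in S q, coefs_in S r &
    s *: a = q * b + r /\ (size r < size b)%N].
Proof.
move=> + Sb b0; have [n] := ubnP (size a); elim: n a => // n IHn a sa Sa.
have [ab|ba] := ltnP (size a) (size b).
  exists 1, 0, a; split; rewrite ?oner_eq0 ?scale1r ?mul0r ?add0r //.
  - exact: (subring1 sS).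
  - by rewrite -polyC0; apply: (coefs_inC sS); apply: (subring0 sS).
have b_gt0 : (0 < size b)%N by rewrite size_poly_gt0.
have lcS p : coefs_in S p -> S (lead_coef p) by move=> Sp; apply: Sp.
pose m := lead_coef a *: 'X^(size a - size b).
have Sm : coefs_in S m by apply: (coefs_inZ sS); [apply: lcS | apply: (coefs_inXn sS)].
pose a' := lead_coef b *: a - m * b.
have Sa' : coefs_in S a'.
  apply: (coefs_inB sS); last exact: (coefs_inM sS).
  by apply: (coefs_inZ sS) => //; apply: lcS.
have a0 : a != 0 by rewrite -size_poly_gt0; lia.
have sa' : (size a' < size a)%N.
  have sm : (size (m * b)) = size a.
    by rewrite -scalerAl mulrC size_scale ?lead_coef_eq0 // size_mulXn // subnK.
  have sba : size (lead_coef b *: a) = size a by rewrite size_scale ?lead_coef_eq0.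
  have : (size a' <= (size a).-1)%N.
    apply/leq_sizeP => j aj; rewrite coefB.
    have [jE|jn] := eqVneq j (size a).-1.
      rewrite coefZ -scalerAl coefZ ['X^_ * b]mulrC coefMXn jE.
      rewrite ifF; last by apply/negbTE; lia.
      have -> : ((size a).-1 - (size a - size b) = (size b).-1)%N by lia.
      by rewrite -!lead_coefE [X in X - _]mulrC subrr.
    have ja : (size a <= j)%N by lia.
    have -> : (lead_coef b *: a)`_j = 0 by apply: nth_default; rewrite sba.
    have -> : (m * b)`_j = 0 by apply: nth_default; rewrite sm.
    by rewrite subrr.
  lia.
have [|s [q [r [Ss s0 Sq Sr [e rb]]]]] := IHn a' _ Sa'; first by lia.
exists (s * lead_coef b), (s *: m + q), r; split => //.
- by apply: (subringM sS) => //; apply: lcS.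
- by rewrite mulf_neq0 // lead_coef_eq0.
- by apply: (coefs_inD sS) => //; apply: (coefs_inZ sS).
- split=> //; rewrite -scalerA mulrDl -addrA -e /a' scalerBr -scalerAl.
  by rewrite [RHS]addrC subrK.
Qed.

Lemma almost_integralB (T : set K) d x y : subring T ->
  (forall n, T (d * x ^+ n)) -> T y -> forall n, T (d * (x - y) ^+ n).
Proof.
move=> sT Tx Ty n; rewrite exprBn mulr_sumr; apply: (subring_sum sT) => i _ _.
rewrite mulrnAr; apply: (subringMn sT); rewrite -mulrA mulrCA.
apply: (subringM sT); first by apply/(subringX sT)/(subringN sT)/(subring1 sT).
by rewrite mulrA; apply: (subringM sT); [apply: Tx | apply: (subringX sT)].
Qed.

Hypothesis (tu : transcendental S u).

Lemma transcendental_inj p q : coefs_in S p -> coefs_in S q -> p.[u] = q.[u] -> p = q.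
Proof.
move=> Sp Sq e; apply/eqP; rewrite -subr_eq0; apply/eqP; apply: tu.
  exact: (coefs_inB sS).
by rewrite hornerD hornerN e subrr.
Qed.

Lemma horner_neq0 p : coefs_in S p -> p != 0 -> p.[u] != 0.
Proof. by move=> Sp; apply: contra_neq; apply: tu. Qed.

(* d r^n = p_n b^n forces size d - 1 >= n (size b - size r) for every n. *)
Lemma almost_integral_proper d r b : coefs_in S d -> coefs_in S r -> coefs_in S b ->
  d != 0 -> b != 0 -> (size r < size b)%N ->
  (forall n, adjoin S u (d.[u] * (r.[u] / b.[u]) ^+ n)) -> r = 0.
Proof.
move=> Sd Sr Sb d0 b0 rb H; apply/eqP; apply: contraT => r0.
(* The exponent [size d] exceeds the degree of [d], which is enough for the contradiction in
   degrees. *)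
have [p Sp e] := H (size d).
have bu := horner_neq0 Sb b0.
have {}e : d * r ^+ size d = p * b ^+ size d.
  apply: transcendental_inj; rewrite ?hornerM ?horner_exp.
  - by apply: (coefs_inM sS) => //; apply: (coefs_inXe sS).
  - by apply: (coefs_inM sS) => //; apply: (coefs_inXe sS).
  - by rewrite -e expr_div_n mulrA divfK // expf_neq0.
have p0 : p != 0.
  have : p * b ^+ size d != 0 by rewrite -e mulf_neq0 // expf_neq0.
  by apply: contra_neq => ->; rewrite mul0r.
move: (congr1 (fun q : {poly K} => size q) e).
rewrite !size_mul ?expf_neq0 // => e1.
have := size_exp r (size d); have := size_exp b (size d).
have rs : (0 < size (r ^+ size d))%N by rewrite size_poly_gt0 expf_neq0.
have bs : (0 < size (b ^+ size d))%N by rewrite size_poly_gt0 expf_neq0.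
have ds : (0 < size d)%N by rewrite size_poly_gt0.
have ps : (0 < size p)%N by rewrite size_poly_gt0.
have r1 : (0 < size r)%N by rewrite size_poly_gt0.
move: e1 rs bs ds ps r1 rb; clear.
move: (size (r ^+ size d)) (size (b ^+ size d)) (size p) => R B P.
move: (size d) (size r) (size b) => n i j. 
move=> *; nia.
Qed.

Hypothesis (cS : completely_integrally_closed S).

(** Induction on the degree of [q]: the top coefficient of [q / s] lies in [S], and removing the top
    term, now an element of [S[u]], preserves almost integrality with the same [d]. *)
Lemma adjoin_scaled q s d : coefs_in S q -> S s -> s != 0 -> coefs_in S d -> d != 0 ->
  (forall n, adjoin S u (d.[u] * (q.[u] / s) ^+ n)) -> adjoin S u (q.[u] / s).
Proof.
move=> + Ss s0 Sd d0; have [n] := ubnP (size q); elim: n q => // n IHn q qn Sq H.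
have [->|q0] := eqVneq q 0.
  by rewrite horner0 mul0r; apply: (subring0 subring_adjoin).
pose c := lead_coef q / s.
have Sc : S c.
  apply: cS; first by exists (lead_coef q), s; split => //; apply: Sq.
  (* Comparing leading coefficients in [d q^m = s^m p] shows that [lead_coef d] is a common
     denominator for the powers of [c]. *)
  exists (lead_coef d) => [|m]; first by rewrite lead_coef_eq0.
  have [p Sp e] := H m.
  have {}e : d * q ^+ m = s ^+ m *: p.
    apply: transcendental_inj; rewrite ?hornerM ?horner_exp ?hornerZ -?e.
    - by apply: (coefs_inM sS) => //; apply: (coefs_inXe sS).
    - by apply: (coefs_inZ sS) => //; apply: (subringX sS).
    - by rewrite expr_div_n mulrCA [X in _ = _ * X]mulrC divfK // expf_neq0.
  have := congr1 (fun q : {poly K} => lead_coef q) e.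
  rewrite lead_coefM lead_coef_exp lead_coefZ expr_div_n mulrA => ->.
  by rewrite mulrC mulKf ?expf_neq0 //; apply: Sp.
pose m := c *: 'X^((size q).-1).
have Sm : coefs_in S m by apply: (coefs_inZ sS) => //; apply: (coefs_inXn sS).
pose q' := q - s *: m.
have qE : q.[u] / s = m.[u] + q'.[u] / s.
  have -> : q'.[u] = q.[u] - s * m.[u] by rewrite /q' hornerD hornerN (hornerZ s m).
  by rewrite mulrBl [s * _]mulrC mulfK // addrC subrK.
rewrite qE; apply: (subringD subring_adjoin); first by exists m.
have q'E : q'.[u] / s = q.[u] / s - m.[u] by rewrite qE addrC addKr.
apply: IHn.
- have q1 : (0 < size q)%N by rewrite size_poly_gt0.
  have : (size q' <= (size q).-1)%N.
    apply/leq_sizeP => j qj; rewrite coefB !coefZ coefXn.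
    have [->|jn] := eqVneq j (size q).-1.
      by rewrite mulr1 -lead_coefE mulrC divfK // subrr.
    by rewrite mulr0n !mulr0 subr0 nth_default // -(prednK q1) ltn_neqAle eq_sym jn.
  by move=> h; apply: leq_ltn_trans h _; rewrite -ltnS prednK.
- by apply: (coefs_inB sS) => //; apply: (coefs_inZ sS).
- rewrite q'E; apply: (almost_integralB subring_adjoin) => //; by exists m.
Qed.

(** Pseudo-division gives [s x = q + r / b]. The proper fraction [r / b] is again almost integral,
    hence 0, and [x = q / s] has a constant denominator. *)
Lemma completely_integrally_closed_adjoin : completely_integrally_closed (adjoin S u).
Proof.
move=> x [_ [_ [[a Sa ->] [b Sb ->] bu0 xE]]] [d0 d0n0 Hd].
have [d Sd dE] : adjoin S u d0 by have := Hd 0%N; rewrite expr0 mulr1.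
have dn0 : d != 0 by apply: contraNneq d0n0; rewrite dE => ->; rewrite horner0.
have bn0 : b != 0 by apply: contraNneq bu0 => ->; rewrite horner0.
rewrite dE in Hd.
have [s [q [r [Ss s0 Sq Sr [e rb]]]]] := pseudo_division Sa Sb bn0.
have sx : s * x = q.[u] + r.[u] / b.[u].
  rewrite xE mulrA -hornerZ e hornerD hornerM mulrDl -mulrA divff // mulr1.
  by [].
have r0 : r = 0.
  apply: (almost_integral_proper Sd Sr Sb) => // n.
  have -> : r.[u] / b.[u] = s * x - q.[u] by rewrite sx addrC addKr.
  apply: (almost_integralB subring_adjoin) => [m|]; last by exists q.
  rewrite exprMn mulrCA; apply: (subringM subring_adjoin) => //.
  by apply: (subringX subring_adjoin); apply: adjoin_base.
have xq : x = q.[u] / s.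
  by move: sx; rewrite r0 horner0 mul0r addr0 => <-; rewrite mulrC mulKf.
by rewrite xq in Hd *; apply: (adjoin_scaled Sq Ss s0 Sd dn0).
Qed.

End CompleteIntegralClosure.

(** * Finitely generated torsion-free abelian groups are free *)

Section FreeBasis.
Set Implicit Arguments.
Unset Strict Implicit.
Variable G : zmodType.

Definition subgroup (P : set G) : Prop := P 0 /\ forall x y, P x -> P y -> P (x - y).

Lemma subgroupN P x : subgroup P -> P x -> P (- x).
Proof. by case=> P0 PB Px; rewrite -sub0r; apply: PB. Qed.

Lemma subgroupD P x y : subgroup P -> P x -> P y -> P (x + y).
Proof. by move=> sP Px Py; rewrite -[y]opprK; apply: (proj2 sP) => //; apply: subgroupN. Qed.

Lemma subgroupMn P x n : subgroup P -> P x -> P (x *+ n).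
Proof.
move=> sP Px; elim: n => [|n IHn]; first by case: sP.
by rewrite mulrS; apply: subgroupD.
Qed.

Lemma subgroupMz P x (n : int) : subgroup P -> P x -> P (x *~ n).
Proof.
move=> sP Px; case: n => n; first by rewrite -pmulrn; apply: subgroupMn.
by rewrite NegzE mulrNz -pmulrn; apply: subgroupN => //; apply: subgroupMn.
Qed.

Fixpoint zspan (es : seq G) : set G :=
  if es is e :: es' then [set x | exists k : int, zspan es' (x - e *~ k)] else [set 0].

(** Independence in triangular form: each generator has infinite order modulo the later ones. This
    is the form that makes each new variable of the tower transcendental over the previous stage. *)
Fixpoint zindep (es : seq G) : Prop :=
  if es is e :: es' then (forall n : nat, zspan es' (e *+ n) -> n = 0%N) /\ zindep es'
  else True.

Lemma subgroup_zspan es : subgroup (zspan es).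
Proof.
elim: es => [|e es [IH0 IHB]]; first by split=> // x y -> ->; rewrite subrr.
split; first by exists 0; rewrite mulr0z subrr.
move=> x y [k xk] [l yl]; exists (k - l).
have -> : x - y - e *~ (k - l) = (x - e *~ k) - (y - e *~ l); last exact: IHB.
by rewrite mulrzBr !opprB [_ *~ l - _]addrC addrACA [- y + _]addrC.
Qed.

Lemma zspan_cons e es : zspan es `<=` zspan (e :: es).
Proof. by move=> x xs; exists 0; rewrite mulr0z subr0. Qed.

Lemma zspan_mem es e : e \in es -> zspan es e.
Proof.
elim: es => // e' es IHes; rewrite inE => /orP[/eqP ->|/IHes]; last exact: zspan_cons.
by exists 1; rewrite mulr1z subrr; case: (subgroup_zspan es).
Qed.

Lemma zspan_min es P : subgroup P -> (forall e, e \in es -> P e) -> zspan es `<=` P.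
Proof.
move=> sP; elim: es => [|e es IHes] Pes x; first by move=> ->; case: sP.
case=> k xk; rewrite -[x](subrK (e *~ k)); apply: subgroupD => //.
  by apply: IHes xk => y ys; apply: Pes; rewrite inE ys orbT.
by apply: subgroupMz => //; apply: Pes; rewrite mem_head.
Qed.

(* If n x = k e modulo the other generators, a unimodular change of the pair (x, e)
   replaces x by an element of finite order modulo the other generators. *)
Lemma zspan_extend (es : seq G) (x : G) : torsion_free G -> zindep es ->
  exists2 es', zindep es' & zspan es' = zspan (x :: es).
Proof.
move=> tfG; elim: es x => [|e es IHes] x.
  move=> _; have [[n n0 xn]|xn] := pselect (exists2 n, n <> 0%N & x *+ n = 0).
    have -> : x = 0 by apply: (tfG n) => //; rewrite lt0n; apply/eqP.
    exists [::] => //; apply/seteqP; split=> [_ -> /=|y /= [k]].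
      by exists 0; rewrite subrr.
    by rewrite mul0rz subr0.
  exists [:: x] => //; split=> // n /= xn0; apply: contrapT => n0.
  by apply: xn; exists n.
move=> [ind_e ind_es].
have [[n n0 xn]|xn] := pselect (exists2 n, n <> 0%N & zspan (e :: es) (x *+ n)); last first.
  exists (x :: e :: es) => //; split=> [n xn0|]; last by split.
  by apply: contrapT => n0; apply: xn; exists n.
have [k xk] := xn; pose g := gcdz n k.
have g0 : g != 0.
  by rewrite gcdz_eq0 negb_and; apply/orP; left; apply/eqP => -[].
have [/dvdzP[n1 nE] /dvdzP[k1 kE]] : (g %| n%:Z)%Z /\ (g %| k)%Z.
  by rewrite dvdz_gcdl dvdz_gcdr.
have [u [v uv]] := Bezoutz n k.
have uv1 : u * n1 + v * k1 = 1.
  apply: (mulIf g0); rewrite mul1r mulrDl -!mulrA -nE -kE; exact: uv.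
(* The matrix with rows [(n1, -k1)] and [(v, u)] has determinant [u n1 + v k1 = 1]; [xE] and [eE]
   record its inverse. Moreover [g x' = n x - k e] lies in [zspan es]. *)
pose x' := x *~ n1 - e *~ k1; pose e' := x *~ v + e *~ u.
have xE : x = x' *~ u + e' *~ k1.
  rewrite mulrzBl mulrzDl -!mulrzA [k1 * u]mulrC addrACA addNr addr0 -mulrzDr.
  by rewrite [n1 * u]mulrC uv1.
have eE : e = e' *~ n1 - x' *~ v.
  rewrite mulrzBl mulrzDl -!mulrzA opprB [e *~ (k1 * v) - _]addrC addrACA.
  by rewrite [v * n1]mulrC addrN add0r -mulrzDr [k1 * v]mulrC uv1.
have [es' ind' span'] := IHes x' ind_es.
exists (e' :: es').
  (* Multiplying by [g] moves [m e'] into [zspan es], because [g x'] is there. Then [m g e] is there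
     as well, and independence of [e] gives [m = 0]. *)
  split=> // m; rewrite span' => -[j e'm].
  have gE : g = `|g|%N :> int by [].
  have sub := subgroup_zspan es.
  have x'g : zspan es (x' *~ g).
    by rewrite mulrzBl -!mulrzA -nE -kE -pmulrn.
  have e'g : zspan es (e' *~ m *~ g).
    rewrite -[e' *~ m](subrK (x' *~ j)) mulrzDl; apply: subgroupD => //.
      exact: subgroupMz.
    by rewrite -mulrzA mulrC mulrzA; apply: subgroupMz.
  have : zspan es (e *+ (m * `|g|)%N).
    have -> : e *+ (m * `|g|)%N = e' *~ m *~ g *~ n1 - x' *~ g *~ (v * m).
      rewrite pmulrn PoszM -gE {1}eE mulrzBl -!mulrzA.
      by congr (_ *~ _ - _ *~ _); ring.
    by apply: (proj2 sub); apply: subgroupMz.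
  move/ind_e/eqP; rewrite muln_eq0 absz_eq0 (negPf g0) orbF => /eqP //.
apply/seteqP; split; apply: zspan_min; try exact: subgroup_zspan.
- move=> y; rewrite inE => /orP[/eqP ->|/zspan_mem].
    by apply: (subgroupD (subgroup_zspan _)); apply: subgroupMz;
      rewrite ?inE; do ?[exact: subgroup_zspan]; apply: zspan_mem; rewrite !inE eqxx ?orbT.
  rewrite span'; move: (y); apply: zspan_min; first exact: subgroup_zspan.
  move=> z; rewrite inE => /orP[/eqP ->|zs]; last by apply: zspan_mem; rewrite !inE zs !orbT.
  apply: (proj2 (subgroup_zspan _)); apply: subgroupMz;
    do ?[exact: subgroup_zspan]; apply: zspan_mem; rewrite !inE eqxx ?orbT //.
- have x's : zspan (e' :: es') x'.
    by apply: zspan_cons; rewrite span'; apply: zspan_mem; apply: mem_head.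
  have e's : zspan (e' :: es') e' by apply: zspan_mem; apply: mem_head.
  have sub := subgroup_zspan (e' :: es').
  move=> y; rewrite inE => /orP[/eqP ->|].
    by rewrite xE; apply: (subgroupD sub); apply: (subgroupMz _ sub).
  rewrite inE => /orP[/eqP ->|ys].
    by rewrite eE; apply: (proj2 sub); apply: (subgroupMz _ sub).
  by apply: zspan_cons; rewrite span'; apply/zspan_cons/zspan_mem.
Qed.

Lemma exists_free_basis (s : seq G) : torsion_free G ->
  exists2 es, zindep es & zspan es = zspan s.
Proof.
move=> tfG; elim: s => [|x s [es ind eE]]; first by exists [::].
have [es' ind' E] := zspan_extend x tfG ind.
by exists es' => //; rewrite E /= eE.
Qed.
End FreeBasis.

Lemma sum_fibers (I D : eqType) (V : nmodType) (r : seq I) (s : seq D) (deg : I -> D)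
    (x : I -> V) :
  uniq s -> (forall i, i \in r -> deg i \in s) ->
  \sum_(i <- r) x i = \sum_(d <- s) \sum_(i <- r | deg i == d) x i.
Proof.
move=> us rs; under [RHS]eq_bigr => d _ do rewrite big_mkcond.
rewrite exchange_big /= big_seq [RHS]big_seq; apply: eq_bigr => i ir.
rewrite (bigD1_seq (deg i)) ?rs //= eqxx big1 ?addr0 // => d.
by rewrite eq_sym => /negPf ->.
Qed.

(** * Homogeneous elements of the homogeneous quotient field *)

Section GradedDomain.
Set Implicit Arguments.
Unset Strict Implicit.
Variables (K : fieldType) (G : zmodType) (Gam : set G) (R : set K) (Rg : G -> set K).
Hypothesis gr : graded_domain Gam R Rg.

Lemma torsion_free_graded : torsion_free G.
Proof. by case: gr => -[_ [_ tf]]. Qed.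

Lemma subring_graded : subring R.
Proof. by case: gr => _ [[R1 [RB [RM _]]] _]. Qed.

Lemma quotient_field_graded x : exists a b, R a /\ R b /\ b != 0 /\ x = a / b.
Proof. by case: gr => _ [[_ [_ [_ +]]] _]; apply. Qed.

Lemma component_sub a : Rg a `<=` R.
Proof. by case: gr => _ [_ [_ [+ _]]]; apply. Qed.

Lemma component0 a : Rg a 0.
Proof. by case: gr => _ [_ [_ [_ [/(_ a)[]]]]]. Qed.

Lemma componentB a x y : Rg a x -> Rg a y -> Rg a (x - y).
Proof. by case: gr => _ [_ [_ [_ [/(_ a)[_ +] _]]]]; apply. Qed.

Lemma componentM a b x y : Rg a x -> Rg b y -> Rg (a + b) (x * y).
Proof. by case: gr => _ [_ [_ [_ [_ [+ _]]]]]; apply. Qed.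

Lemma component_dec r : R r -> exists (s : seq G) (c : G -> K),
  (forall a, Rg a (c a)) /\ r = \sum_(a <- s) c a.
Proof. by case: gr => _ [_ [_ [_ [_ [_ [+ _]]]]]]; apply. Qed.

Lemma component_direct (s : seq G) (c : G -> K) : uniq s -> (forall a, Rg a (c a)) ->
  \sum_(a <- s) c a = 0 -> forall a, a \in s -> c a = 0.
Proof. by case: gr => _ [_ [_ [_ [_ [_ [_ +]]]]]]; apply. Qed.

Lemma componentD a x y : Rg a x -> Rg a y -> Rg a (x + y).
Proof.
move=> ax ay; rewrite -[y]opprK; apply: componentB => //.
by rewrite -sub0r; apply: componentB => //; apply: component0.
Qed.

Lemma exists_homogeneous : exists b h, Rg b h /\ h != 0.
Proof.
have [s [c [Rc e]]] := component_dec (subring1 subring_graded).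
apply: contrapT => H; suff /eqP : (1 : K) = 0 by rewrite oner_eq0.
rewrite e big1 // => a _; apply: contrapT => /eqP ca.
by apply: H; exists a, (c a).
Qed.

(* The degree-[a] part of the homogeneous quotient field. *)
Definition RHg (a : G) : set K :=
  [set x | exists b r h, [/\ Rg (a + b) r, Rg b h, h != 0 & x = r / h]].

Lemma RHg_component a x : Rg a x -> RHg a x.
Proof.
have [b [h [bh h0]]] := exists_homogeneous => ax.
by exists b, (x * h), h; split; rewrite ?mulfK //; apply: componentM.
Qed.

Lemma RHg0 a : RHg a 0.
Proof. by apply: RHg_component; apply: component0. Qed.

Lemma RHgB a x y : RHg a x -> RHg a y -> RHg a (x - y).
Proof.
move=> [b [r [h [ar bh h0 ->]]]] [b' [r' [h' [ar' bh' h0' ->]]]].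
exists (b + b'), (r * h' - r' * h), (h * h'); split.
- apply: componentB; first by rewrite addrA; apply: componentM.
  by rewrite [b + b']addrC addrA; apply: componentM.
- exact: componentM.
- exact: mulf_neq0.
- by field; rewrite h0 h0'.
Qed.

Lemma RHgN a x : RHg a x -> RHg a (- x).
Proof. by rewrite -sub0r; apply: RHgB; apply: RHg0. Qed.

Lemma RHgD a x y : RHg a x -> RHg a y -> RHg a (x + y).
Proof. by move=> ax ay; rewrite -[y]opprK; apply: RHgB => //; apply: RHgN. Qed.

Lemma RHgM a b x y : RHg a x -> RHg b y -> RHg (a + b) (x * y).
Proof.
move=> [c [r [h [ar bh h0 ->]]]] [c' [r' [h' [ar' bh' h0' ->]]]].
exists (c + c'), (r * r'), (h * h'); split.
- by rewrite addrACA; apply: componentM.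
- exact: componentM.
- exact: mulf_neq0.
- by field; rewrite h0 h0'.
Qed.

Lemma RHgV a x : RHg a x -> RHg (- a) x^-1.
Proof.
have [->|x0] := eqVneq x 0; first by rewrite invr0 => _; apply: RHg0.
move=> [c [r [h [ar ch h0 xE]]]]; exists (a + c), h, r; rewrite addKr; split=> //.
  by apply: contraNneq x0 => r0; rewrite xE r0 mul0r.
by rewrite xE invf_div.
Qed.

Lemma RHg1 : RHg 0 1.
Proof.
have [b [h [bh h0]]] := exists_homogeneous.
by exists b, h, h; rewrite add0r divff.
Qed.

Lemma RHg_sum a (I : eqType) (r : seq I) (P : pred I) (F : I -> K) :
  (forall i, i \in r -> P i -> RHg a (F i)) -> RHg a (\sum_(i <- r | P i) F i).
Proof.
move=> aF; rewrite big_seq_cond; apply: big_ind => [||i /andP[]]; last exact: aF.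
  exact: RHg0.
exact: RHgD.
Qed.

(** A product of the individual denominators. Having one shift [b] for all indices keeps equal
    degrees equal, so that questions about [R_H] descend to [R]. *)
Lemma common_denominator (I : eqType) (r : seq I) (deg : I -> G) (x : I -> K) :
  (forall i, i \in r -> RHg (deg i) (x i)) ->
  exists b h, [/\ Rg b h, h != 0 & forall i, i \in r -> Rg (deg i + b) (x i * h)].
Proof.
elim: r => [|i r IHr] Hr.
  by have [b [h [bh h0]]] := exists_homogeneous; exists b, h.
have [|b [h [bh h0 H]]] := IHr; first by move=> j jr; apply: Hr; rewrite inE jr orbT.
have [c [s [k [as_ ck k0 e]]]] := Hr i (mem_head _ _).
exists (c + b), (k * h); split; [exact: componentM | exact: mulf_neq0 |].
move=> j; rewrite inE => /orP[/eqP ->|/H jh].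
  rewrite addrA (_ : x i * (k * h) = s * h); first exact: componentM.
  by rewrite e; field.
by rewrite addrCA mulrCA; apply: componentM.
Qed.

Lemma RHg_direct (I : eqType) (r : seq I) (deg : I -> G) (x : I -> K) :
  (forall i, i \in r -> RHg (deg i) (x i)) -> \sum_(i <- r) x i = 0 ->
  forall a, \sum_(i <- r | deg i == a) x i = 0.
Proof.
move=> /common_denominator[b [h [bh h0 H]]] sum0 a.
pose c d := \sum_(i <- r | deg i + b == d) x i * h.
pose s := undup [seq deg i + b | i <- r].
have Rc d : Rg d (c d).
  rewrite /c big_seq_cond; apply: big_ind; [exact: component0|exact: componentD|].
  by move=> i /andP[/H + /eqP <-].
have rs i : i \in r -> deg i + b \in s by move=> ir; rewrite mem_undup; apply: map_f.
have cs : \sum_(d <- s) c d = 0.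
  by rewrite -(@sum_fibers _ _ _ r s (fun i => deg i + b)) ?undup_uniq // -mulr_suml sum0 mul0r.
have cE : c (a + b) = (\sum_(i <- r | deg i == a) x i) * h.
  by rewrite mulr_suml; apply: eq_bigl => i; rewrite (inj_eq (addIr b)).
have ca : c (a + b) = 0.
  have [abs|abs] := boolP (a + b \in s).
    exact: (component_direct (undup_uniq _) Rc cs).
  rewrite /c big_seq_cond big1 // => i /andP[/rs + /eqP e].
  by rewrite e (negPf abs).
by move/eqP: cE; rewrite ca eq_sym mulf_eq0 (negPf h0) orbF => /eqP.
Qed.

(** The difference of the two sums, indexed by the disjoint union, is a vanishing homogeneous sum.
    Components in [R_H] are therefore independent of the fraction that defines them. *)
Lemma RHg_unique (I J : eqType) (r : seq I) (s : seq J) (deg : I -> G) (deg' : J -> G)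
    (x : I -> K) (y : J -> K) :
  (forall i, i \in r -> RHg (deg i) (x i)) -> (forall j, j \in s -> RHg (deg' j) (y j)) ->
  \sum_(i <- r) x i = \sum_(j <- s) y j ->
  forall a, \sum_(i <- r | deg i == a) x i = \sum_(j <- s | deg' j == a) y j.
Proof.
move=> Hx Hy e a; apply/eqP; rewrite -subr_eq0; apply/eqP.
pose u := [seq inl i | i <- r] ++ [seq inr j | j <- s] : seq (I + J).
pose degu k := match k with inl i => deg i | inr j => deg' j end.
pose z k := match k with inl i => x i | inr j => - y j end.
have Hz k : k \in u -> RHg (degu k) (z k).
  rewrite mem_cat => /orP[/mapP[i ir ->]|/mapP[j js ->]] /=; first exact: Hx.
  by apply: RHgN; apply: Hy.
have z0 : \sum_(k <- u) z k = 0 by rewrite big_cat !big_map /= sumrN e subrr.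
by have := RHg_direct Hz z0 a; rewrite big_cat !big_map /= sumrN.
Qed.

(** * Elements of [R_H] with degrees in a prescribed set *)

Definition RHsum (E : set G) : set K :=
  [set x | exists r : seq (G * K),
     (forall p, p \in r -> E p.1 /\ RHg p.1 p.2) /\ x = \sum_(p <- r) p.2].

Lemma RHsum_homog (E : set G) a x : E a -> RHg a x -> RHsum E x.
Proof.
move=> Ea ax; exists [:: (a, x)]; rewrite big_seq1; split=> // p.
by rewrite inE => /eqP ->.
Qed.

Lemma RHsum0 E : RHsum E 0.
Proof. by exists [::]; rewrite big_nil. Qed.

Lemma RHsumD E x y : RHsum E x -> RHsum E y -> RHsum E (x + y).
Proof.
move=> [r [Hr ->]] [s [Hs ->]]; exists (r ++ s); rewrite big_cat; split=> // p.
by rewrite mem_cat => /orP[/Hr|/Hs].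
Qed.

Lemma RHsum_sum E (I : eqType) (r : seq I) (P : pred I) (F : I -> K) :
  (forall i, i \in r -> P i -> RHsum E (F i)) -> RHsum E (\sum_(i <- r | P i) F i).
Proof.
move=> aF; rewrite big_seq_cond; apply: big_ind => [||i /andP[]]; last exact: aF.
  exact: RHsum0.
exact: RHsumD.
Qed.

Lemma RHsumM (E E' E'' : set G) x y : (forall a b, E a -> E' b -> E'' (a + b)) ->
  RHsum E x -> RHsum E' y -> RHsum E'' (x * y).
Proof.
move=> EE [r [Hr ->]] [s [Hs ->]]; rewrite mulr_suml; apply: RHsum_sum => p pr _.
rewrite mulr_sumr; apply: RHsum_sum => q qs _.
have [[Ep Hp] [Eq Hq]] := (Hr p pr, Hs q qs).
by apply: (RHsum_homog (EE _ _ Ep Eq)); apply: RHgM.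
Qed.

Lemma RHsumN E x : RHsum E x -> RHsum E (- x).
Proof.
move=> [r [Hr ->]]; rewrite -sumrN; apply: RHsum_sum => p /Hr[Ep Hp] _.
exact: RHsum_homog Ep (RHgN Hp).
Qed.

Lemma subring_RHsum E : subgroup E -> subring (RHsum E).
Proof.
move=> sE; split.
- by apply: (RHsum_homog (proj1 sE)); apply: RHg1.
- by move=> x y Ex Ey; apply: RHsumD => //; apply: RHsumN.
- by move=> x y; apply: RHsumM => a b; apply: subgroupD.
Qed.

Lemma RHsumT : RH R Rg = RHsum setT.
Proof.
apply/seteqP; split=> x.
  move=> [a [h [/component_dec[s [c [Rc ->]]] [[h0 [b bh]] ->]]]].
  rewrite mulr_suml; apply: RHsum_sum => d _ _.
  apply: (@RHsum_homog _ (d - b)) => //.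
  by exists b, (c d), h; rewrite subrK.
move=> [r [Hr ->]].
have [|b [h [bh h0 H]]] := @common_denominator _ r fst snd; first by move=> p /Hr[].
exists ((\sum_(p <- r) p.2) * h), h; split; last first.
  by split; [split => //; exists b | rewrite mulfK].
rewrite mulr_suml; apply: (subring_sum subring_graded) => p pr _.
by apply: (@component_sub (p.1 + b)); apply: H.
Qed.

Lemma subring_RH : subring (RH R Rg).
Proof. by rewrite RHsumT; apply: subring_RHsum. Qed.

Lemma sub_RH : R `<=` RH R Rg.
Proof.
move=> _ /component_dec[s [c [Rc ->]]]; rewrite RHsumT; apply: RHsum_sum => d _ _.
by apply: (@RHsum_homog _ d) => //; apply: RHg_component.
Qed.

(** [hcomp] reads components off a fraction [r / h]; by uniqueness every homogeneous decomposition
    gives the same ones. An unoccupied degree contributes the component 0. *)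
Lemma hcompE (I : eqType) (r : seq I) (deg : I -> G) (x : I -> K) :
  (forall i, i \in r -> RHg (deg i) (x i)) ->
  hcomp Rg (\sum_(i <- r) x i) = [set y | exists a, y = \sum_(i <- r | deg i == a) x i].
Proof.
move=> Hr; apply/seteqP; split=> y.
  move=> [q [h [s [c [[h0 [b bh]] [e [Rc [us [qE [a as_ ->]]]]]]]]]].
  exists (a - b); rewrite (@RHg_unique _ _ r s deg (fun d => d - b) x (fun d => c d / h)) //.
  - rewrite big_mkcond (bigD1_seq a) //= eqxx big1 ?addr0 // => d da.
    by rewrite (inj_eq (addIr (- b))) (negPf da).
  - by move=> d _; exists b, (c d), h; rewrite subrK.
  - by rewrite e qE mulr_suml.
move=> [a ->]; have [b [h [bh h0 H]]] := common_denominator Hr.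
pose c d := \sum_(i <- r | deg i + b == d) x i * h.
(* The degree [a + b] is listed even when no term has it, so that the zero component is reached
   too. *)
pose s := undup (a + b :: [seq deg i + b | i <- r]).
have rs i : i \in r -> deg i + b \in s.
  by move=> ir; rewrite mem_undup inE (map_f (fun i => deg i + b) ir) orbT.
exists (\sum_(d <- s) c d), h, s, c; split; first by split => //; exists b.
split.
  by rewrite -(@sum_fibers _ _ _ r s (fun i => deg i + b)) ?undup_uniq // -mulr_suml mulfK.
split.
  move=> d; rewrite /c big_seq_cond; apply: big_ind; [exact: component0|exact: componentD|].
  by move=> i /andP[/H + /eqP <-].
split; first exact: undup_uniq.
split=> //; exists (a + b); first by rewrite mem_undup mem_head.
rewrite /c -mulr_suml mulfK //.
by apply: eq_bigl => i; rewrite (inj_eq (addIr b)).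
Qed.

(** * Polynomials over [R_H] as elements graded by degree and exponent *)

Lemma poly_RH_terms (f : {poly K}) : coefs_in (RH R Rg) f ->
  exists (s : seq (G * nat)) (F : G * nat -> K),
    [/\ uniq s, forall d, RHg d.1 (F d) & f = \sum_(d <- s) F d *: 'X^(d.2)].
Proof.
move=> Hf.
suff [r [Hr ->]] : exists r : seq ((G * nat) * K), (forall p, p \in r -> RHg p.1.1 p.2) /\
    f = \sum_(p <- r) p.2 *: 'X^(p.1.2).
  exists (undup [seq p.1 | p <- r]), (fun d => \sum_(p <- r | p.1 == d) p.2).
  split=> [|d|]; first exact: undup_uniq.
    by apply: RHg_sum => p /Hr + /eqP <-.
  rewrite (@sum_fibers _ _ _ r (undup [seq p.1 | p <- r]) fst) ?undup_uniq //.
    apply: eq_bigr => d _; rewrite scaler_suml; apply: eq_bigr => p /eqP ->.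
    by [].
  by move=> p pr; rewrite mem_undup; apply: map_f.
rewrite -[f]coefK poly_def.
pose P g := exists r : seq ((G * nat) * K), (forall p, p \in r -> RHg p.1.1 p.2) /\
    g = \sum_(p <- r) p.2 *: 'X^(p.1.2).
apply: (big_ind P) => [|g h [r [Hr ->]] [s [Hs ->]]|i _].
- by exists [::]; rewrite big_nil.
- exists (r ++ s); rewrite big_cat; split=> // p.
  by rewrite mem_cat => /orP[/Hr|/Hs].
have := Hf i; rewrite RHsumT => -[r [Hr ->]].
exists [seq ((p.1, i : nat), p.2) | p <- r]; rewrite big_map /=; split.
  by move=> p /mapP[q qr ->] /=; case: (Hr q qr).
by rewrite scaler_suml.
Qed.

Lemma coef_terms (I : Type) (r : seq I) (deg : I -> G * nat) (x : I -> K) i :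
  (\sum_(j <- r) x j *: 'X^((deg j).2))`_i = \sum_(j <- r | (deg j).2 == i) x j.
Proof.
rewrite coef_sum [RHS]big_mkcond; apply: eq_bigr => j _.
by rewrite coefZ coefXn eq_sym; case: eqP => _; rewrite ?mulr1 ?mulr0.
Qed.

Lemma hcomp_coef (I : eqType) (r : seq I) (deg : I -> G * nat) (x : I -> K) i :
  (forall j, j \in r -> RHg (deg j).1 (x j)) ->
  hcomp Rg (\sum_(j <- r) x j *: 'X^((deg j).2))`_i =
  [set y | exists a, y = \sum_(j <- r | deg j == (a, i)) x j].
Proof.
move=> Hr; rewrite coef_terms -big_filter.
rewrite (@hcompE _ _ (fun j => (deg j).1)) => [|j]; last first.
  by rewrite mem_filter => /andP[_ /Hr].
apply/seteqP; split=> y [a ->]; exists a; rewrite big_filter_cond; apply: eq_bigl => j;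
  by rewrite -pair_eqE /= /pair_eq /= andbC.
Qed.

(** Repeated degrees are allowed because the terms of a product, indexed by pairs, have them. *)
Lemma Apoly_terms (I : eqType) (r : seq I) (deg : I -> G * nat) (x : I -> K) :
  (forall j, j \in r -> RHg (deg j).1 (x j)) ->
  Apoly R Rg (\sum_(j <- r) x j *: 'X^((deg j).2)) =
  span R [set y | exists d, y = \sum_(j <- r | deg j == d) x j].
Proof.
move=> Hr; set f := \sum_(j <- r) _.
have sR := subring_graded.
have sspan := submodule_span sR [set y | exists d, y = \sum_(j <- r | deg j == d) x j].
apply/seteqP; split.
  move=> _ [e [He ->]]; apply: (submodule_sum (S := R)) => // i _.
  have := He i; apply: (span_min sspan) => y; rewrite hcomp_coef // => -[a ->].
  by apply: (span_gen sR); exists (a, i : nat).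
have [A0 AD AZ] : submodule R (Apoly R Rg f).
  have C i := submodule_span sR (hcomp Rg f`_i).
  split.
  - exists (fun=> 0); rewrite big1 //; split=> // i; by case: (C i).
  - move=> _ _ [e [He ->]] [e' [He' ->]]; exists (fun i => e i + e' i).
    rewrite big_split; split=> // i; case: (C i) => _ CD _.
    exact: CD (He i) (He' i).
  - move=> a _ Ra [e [He ->]]; exists (fun i => a * e i).
    rewrite mulr_sumr; split=> // i; case: (C i) => _ _ CZ.
    exact: CZ Ra (He i).
apply: span_min => // _ [[a i] ->].
have y_hcomp : hcomp Rg f`_i (\sum_(j <- r | deg j == (a, i)) x j).
  by rewrite hcomp_coef //; exists a.
have [lt_i|le_i] := ltnP i (size f).
  exists (fun j => if j == Ordinal lt_i then \sum_(j <- r | deg j == (a, i)) x j else 0).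
  split; last by rewrite (bigD1 (Ordinal lt_i)) //= eqxx [X in _ + X]big1 ?addr0 // => j /negPf ->.
  move=> j; case: eqP => [->|_]; first exact: (span_gen sR).
  by case: (submodule_span sR (hcomp Rg f`_j)).
(* From [size f] on, the coefficient is 0, whose only component, computed from the empty family, is
   0. *)
suff -> : \sum_(j <- r | deg j == (a, i)) x j = 0 by [].
have h0 : hcomp Rg 0 = [set y | exists a, y = \sum_(p <- [::] : seq (G * K) | p.1 == a) p.2].
  by have := @hcompE (G * K)%type [::] fst snd; rewrite big_nil => ->.
by move: y_hcomp; rewrite nth_default // h0 => -[b ->]; rewrite big_nil.
Qed.

(** * Integral closedness of the homogeneous quotient field *)

Definition supported : set G := [set a | exists2 u, RHg a u & u != 0].

Lemma subgroup_supported : subgroup supported.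
Proof.
split; first by exists 1; [apply: RHg1 | apply: oner_neq0].
move=> a b [u au u0] [v bv v0]; exists (u / v); first exact: RHgM au (RHgV bv).
by rewrite mulf_neq0 ?invr_neq0.
Qed.

Lemma RHgX a u n : RHg a u -> RHg (a *+ n) (u ^+ n).
Proof.
move=> au; elim: n => [|n IHn]; first exact: RHg1.
by rewrite mulrS exprS; apply: RHgM.
Qed.

Lemma RHgXz a u (k : int) : RHg a u -> RHg (a *~ k) (u ^ k).
Proof.
move=> au; case: k => n; first by rewrite -pmulrn -exprnP; apply: RHgX.
by rewrite NegzE mulrNz -pmulrn -exprnN; apply/RHgV/RHgX.
Qed.

Lemma subring_RHg0 : subring (RHg 0).
Proof.
split; [exact: RHg1 | exact: RHgB |].
by move=> x y Hx Hy; have := RHgM Hx Hy; rewrite addr0.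
Qed.

(** [RHg 0] is a field, hence contains all its fractions. *)
Lemma completely_integrally_closed_RHg0 : completely_integrally_closed (RHg 0).
Proof.
move=> x [a [b [Ha Hb _ ->]]] _.
by rewrite -[0 : G]addr0 -{2}[0 : G]oppr0; apply: RHgM => //; apply: RHgV.
Qed.

Lemma RHsum_mono (E F : set G) : E `<=` F -> RHsum E `<=` RHsum F.
Proof. by move=> EF x [r [Hr ->]]; exists r; split=> // p /Hr[/EF]. Qed.

Lemma RHsum_split (E : set G) x y : RHsum E x -> RHsum (~` E) y -> x + y = 0 -> x = 0.
Proof.
move=> [r [Hr xE]] /RHsumN[s [Hs yE]] /eqP; rewrite addr_eq0 => /eqP xy.
have e a : \sum_(p <- r | p.1 == a) p.2 = \sum_(p <- s | p.1 == a) p.2.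
  by apply: RHg_unique; rewrite -?xE -?yE // => p; [case/Hr | case/Hs].
rewrite xE (@sum_fibers _ _ _ r (undup [seq p.1 | p <- r]) fst) ?undup_uniq //; last first.
  by move=> p pr; rewrite mem_undup; apply: map_f.
rewrite big_seq big1 // => a; rewrite mem_undup => /mapP[p /Hr[Ep _] ->].
rewrite e big_seq_cond big1 // => q /andP[/Hs[Eq _] /eqP qp].
by case: Eq; rewrite qp.
Qed.

Lemma transcendental_RHsum (E : set G) a u : subgroup E -> RHg a u -> u != 0 ->
  (forall n : nat, E (a *+ n) -> n = 0%N) -> transcendental (RHsum E) u.
Proof.
move=> sE au u0 ind p Ep pu; apply/eqP; apply: contraT => p0.
pose n := (size p).-1; have sp : size p = n.+1 by rewrite prednK // size_poly_gt0.
suff : p`_n = 0 by rewrite -lead_coefE => /eqP; rewrite lead_coef_eq0 (negPf p0).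
(* After division by [u ^+ n] the leading coefficient has degrees in [E], while the term of index
   [i < n] has degrees in [E - (n - i) a]. This misses [E], since no positive multiple of [a] lies
   in [E]. *)
apply: (@RHsum_split E _ (\sum_(i < n) p`_i * (u ^+ i / u ^+ n))) => //.
  apply: RHsum_sum => i _ _.
  apply: (RHsumM _ (Ep i) (@RHsum_homog [set a *+ i - a *+ n] _ _ _ _)) => //.
    move=> b _ Eb -> Es; have := ltn_ord i; rewrite -subn_gt0.
    suff -> : (n - i = 0)%N by [].
    apply: ind; rewrite mulrnBr ?(ltnW (ltn_ord i)) //.
    have -> : a *+ n - a *+ i = b - (b + (a *+ i - a *+ n)).
      by rewrite opprD opprB addrA subrr add0r.
    exact: (proj2 sE).
  by apply: RHgM; [apply: RHgX | apply/RHgV/RHgX].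
apply: (mulIf (expf_neq0 n u0)); rewrite mul0r mulrDl mulr_suml.
under eq_bigr => i _ do rewrite -mulrA divfK ?expf_neq0 //.
by rewrite addrC; move: pu; rewrite horner_coef sp big_ord_recr.
Qed.

(* The part of the homogeneous quotient field with degrees in [zspan es] is the Laurent
   polynomial ring in the [u e] over its degree-0 part; [tower] is the polynomial ring. *)
Fixpoint tower (u : G -> K) (es : seq G) : set K :=
  if es is e :: es' then adjoin (tower u es') (u e) else RHg 0.

Definition graded_units (u : G -> K) (es : seq G) : Prop :=
  forall e, e \in es -> RHg e (u e) /\ u e != 0.

Lemma graded_units_cons u e es : graded_units u (e :: es) ->
  [/\ RHg e (u e), u e != 0 & graded_units u es].
Proof.
move=> H; have [eu ue0] := H e (mem_head _ _); split=> // e' e's.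
by apply: H; rewrite inE e's orbT.
Qed.

Lemma subring_tower u es : subring (tower u es).
Proof.
by elim: es => [|e es IHes]; [apply: subring_RHg0 | apply: subring_adjoin].
Qed.

Lemma tower_sub u es : graded_units u es -> tower u es `<=` RHsum (zspan es).
Proof.
elim: es => [_ x|e es IHes]; first exact: RHsum_homog.
move=> /graded_units_cons[eu ue0 /IHes sub] _ [p Hp ->].
have sR := subring_RHsum (subgroup_zspan (e :: es)).
rewrite horner_coef; apply: (subring_sum sR) => i _ _; apply: (subringM sR).
  by apply: RHsum_mono (sub _ (Hp i)); apply: zspan_cons.
by apply/(subringX sR)/(RHsum_homog _ eu); apply/zspan_mem/mem_head.
Qed.

Lemma completely_integrally_closed_tower u es : graded_units u es -> zindep es ->
  completely_integrally_closed (tower u es).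
Proof.
elim: es => [_ _|e es IHes]; first exact: completely_integrally_closed_RHg0.
move=> /graded_units_cons[eu ue0 Hu] [inde ind].
apply: (completely_integrally_closed_adjoin (subring_tower u es)); last exact: IHes.
move=> p Hp; apply: (transcendental_RHsum (subgroup_zspan es) eu ue0 inde).
by move=> i; apply: tower_sub (Hp i).
Qed.

(** A high power of the product of the variables makes every exponent nonnegative. The claim covers
    all larger powers, so that finitely many elements can share one exponent. *)
Lemma tower_clear u es a z : graded_units u es -> zspan es a -> RHg a z ->
  exists N, forall M, (N <= M)%N -> tower u es (z * (\prod_(e <- es) u e) ^+ M).
Proof.
elim: es a z => [|e es IHes] a z.
  by move=> _ -> Hz; exists 0%N => M _; rewrite big_nil expr1n mulr1.
move=> /graded_units_cons[eu ue0 Hu] [k ak] az.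
have [|N HN] := IHes (a - e *~ k) (z * u e ^ (- k)) Hu ak.
  by rewrite -mulrNz; apply: RHgM => //; apply: RHgXz.
exists (maxn N `|k|) => M; rewrite geq_max => /andP[NM kM].
have sT := subring_tower u es.
have [n nE] : exists n : nat, n%:Z = k + M%:Z by exists (absz (k + M%:Z)); lia.
have -> : z * (\prod_(j <- e :: es) u j) ^+ M =
    z * u e ^ (- k) * (\prod_(j <- es) u j) ^+ M * u e ^+ n.
  have -> : u e ^+ n = u e ^ k * u e ^+ M by rewrite exprnP nE expfzDr.
  have uk : u e ^ (- k) * u e ^ k = 1 by rewrite -expfzDr // addNr expr0z.
  rewrite big_cons exprMn -[z in LHS]mulr1 -uk.
  by move: (u e ^ (- k)) (u e ^ k) => v v'; ring.
apply: (subringM (subring_adjoin sT _)); first by apply: (adjoin_base sT); apply: HN.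
exact/(subringX (subring_adjoin sT _))/(adjoin_gen sT).
Qed.

Lemma tower_clear_seq u es (l : seq K) : graded_units u es ->
  (forall y, y \in l -> RHsum (zspan es) y) ->
  exists N, forall y, y \in l -> forall M, (N <= M)%N ->
    tower u es (y * (\prod_(e <- es) u e) ^+ M).
Proof.
move=> Hu; elim: l => [|y l IHl] Hl; first by exists 0%N.
have [|N HN] := IHl; first by move=> z zl; apply: Hl; rewrite inE zl orbT.
have [r [Hr yE]] := Hl y (mem_head _ _).
have sT := subring_tower u es.
have [N' HN'] : exists N, forall M, (N <= M)%N -> tower u es (y * (\prod_(e <- es) u e) ^+ M).
  rewrite yE big_seq; apply: (big_ind (fun z => exists N, forall M, (N <= M)%N ->
    tower u es (z * (\prod_(e <- es) u e) ^+ M))).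
  - by exists 0%N => M _; rewrite mul0r; apply: (subring0 sT).
  - move=> z z' [n Hn] [n' Hn']; exists (maxn n n') => M; rewrite geq_max => /andP[nM n'M].
    by rewrite mulrDl; apply: (subringD sT); [apply: Hn | apply: Hn'].
  - by move=> p /Hr[]; apply: tower_clear.
exists (maxn N N') => z; rewrite inE => zl M; rewrite geq_max => /andP[NM N'M].
by case/orP: zl => [/eqP ->|zl]; [apply: HN' | apply: HN].
Qed.

Lemma finite_degrees (l : seq K) : (forall y, y \in l -> RH R Rg y) ->
  exists s : seq G, (forall e, e \in s -> supported e) /\
    forall y, y \in l -> RHsum (zspan s) y.
Proof.
elim: l => [|y l IHl] Hl; first by exists [::].
have [|s [Hs ls]] := IHl; first by move=> z zl; apply: Hl; rewrite inE zl orbT.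
have := Hl y (mem_head _ _); rewrite RHsumT => -[r [Hr yE]].
(* Dropping zero terms makes every listed degree the degree of a nonzero homogeneous element. *)
pose t := [seq p.1 | p <- r & p.2 != 0]; exists (t ++ s); split.
  move=> e; rewrite mem_cat => /orP[|/Hs //].
  move=> /mapP[p]; rewrite mem_filter => /andP[p0 /Hr[_ Hp]] ->.
  by exists p.2.
have mono (v : seq G) : {subset v <= t ++ s} -> zspan v `<=` zspan (t ++ s).
  move=> sub; apply: zspan_min; first exact: subgroup_zspan.
  by move=> e /sub; apply: zspan_mem.
move=> z; rewrite inE => /orP[/eqP ->|/ls]; last first.
  by apply/RHsum_mono/mono => e; rewrite mem_cat orbC => ->.
rewrite yE; apply: RHsum_sum => p pr _.
have [->|p0] := eqVneq p.2 0; first exact: RHsum0.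
apply: (RHsum_homog _ (proj2 (Hr p pr))); apply: zspan_mem.
by rewrite mem_cat map_f // mem_filter p0.
Qed.

Lemma integrally_closed_RH : integrally_closed (RH R Rg).
Proof.
move=> x [p [mp [Hp px]]].
have [a [b [Ra [Rb [b0 xE]]]]] := quotient_field_graded x.
have [|s [Hs ls]] := @finite_degrees (a :: b :: p).
  move=> y; rewrite !inE => /or3P[/eqP ->|/eqP ->|]; [exact: sub_RH | exact: sub_RH |].
  by move=> /(nthP 0)[i _ <-]; apply: Hp.
have [es ind esE] := exists_free_basis s torsion_free_graded.
have [u Hu] : exists u : G -> K, graded_units u es.
  (* Supported degrees form a subgroup, so each basis element carries a nonzero homogeneous element
     to serve as a variable; elsewhere the value is arbitrary. *)
  have /choice[u Hu] : forall e, exists ue, supported e -> RHg e ue /\ ue != 0.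
    move=> e; have [[ue eu ue0]|ne] := pselect (supported e); first by exists ue.
    by exists 0.
  exists u => e /zspan_mem; rewrite esE => es_; apply: Hu.
  exact: (zspan_min subgroup_supported Hs).
have [|N HN] := @tower_clear_seq u es (a :: b :: p) Hu; first by rewrite esE.
set w := \prod_(e <- es) u e in HN.
have sT := subring_tower u es.
have w0 : w != 0.
  rewrite /w big_seq; apply: (big_ind (fun v => v != 0)) => [|y z|e /Hu[]//].
    exact: oner_neq0.
  exact: mulf_neq0.
have Tw : tower u es (w ^+ N).
  have -> : w ^+ N = p`_(size p).-1 * w ^+ N by rewrite -lead_coefE (monicP mp) mul1r.
  apply: HN => //; rewrite !inE mem_nth ?orbT //.
  by rewrite prednK // size_poly_gt0 monic_neq0.
pose n := (size p).-1.
have sp : size p = n.+1 by rewrite prednK // size_poly_gt0 monic_neq0.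
(* The equation of [x] multiplied by [w ^+ (N * n)]: monic, with root [w ^+ N * x]. For [i < n] the
   exponent [N * (n - i)] is at least [N], so the coefficient lies in the tower. *)
pose q := \poly_(i < n.+1) (p`_i * w ^+ (N * (n - i))).
have qn : p`_n * w ^+ (N * (n - n)) = 1.
  by rewrite subnn muln0 mulr1 -lead_coefE (monicP mp).
have sq : size q = n.+1 by apply: size_poly_eq; rewrite qn oner_neq0.
have Ty : tower u es (w ^+ N * x).
  have fr : fractions (tower u es) (w ^+ N * x).
    exists (a * w ^+ (N + N)), (b * w ^+ N); split.
    - by apply: HN; rewrite ?mem_head // leq_addr.
    - by apply: HN => //; rewrite !inE eqxx orbT.
    - by rewrite mulf_neq0 ?expf_neq0.
    - by rewrite xE exprD; field; rewrite b0 expf_neq0.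
  apply: (completely_integrally_closed_tower Hu ind fr).
  apply: (almost_integral_of_integral (q := q) sT fr).
  - by rewrite monicE lead_coefE sq /= coef_poly ltnSn qn.
  - move=> i; rewrite coef_poly; case: ltnP => [ilt|_]; last exact: (subring0 sT).
    have [->|iN] := eqVneq i n; first by rewrite qn; apply: (subring1 sT).
    have ni : (i < n)%N by rewrite ltn_neqAle iN -ltnS.
    apply: HN; first by rewrite !inE mem_nth ?orbT // sp.
    by rewrite leq_pmulr // subn_gt0.
  - rewrite /root horner_poly.
    have -> : \sum_(i < n.+1) p`_i * w ^+ (N * (n - i)) * (w ^+ N * x) ^+ i =
        w ^+ (N * n) * p.[x].
      rewrite horner_coef sp mulr_sumr; apply: eq_bigr => i _.
      have -> : w ^+ (N * n) = w ^+ (N * (n - i)) * (w ^+ N) ^+ i.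
        by rewrite -exprM -exprD -mulnDr subnK // -ltnS.
      by rewrite exprMn; ring.
    by rewrite (eqP px) mulr0.
(* [w] is a nonzero homogeneous element, so its powers are invertible in [R_H]. *)
rewrite -[x](mulKf (expf_neq0 N w0)); apply: (subringM subring_RH); last first.
  rewrite RHsumT; apply: RHsum_mono (tower_sub Hu Ty) => //.
rewrite RHsumT; have [d wd] : exists d, RHg d w.
  rewrite /w big_seq; apply: (big_ind (fun w => exists d, RHg d w)).
  - by exists 0; apply: RHg1.
  - by move=> y z [d dy] [d' dz]; exists (d + d'); apply: RHgM.
  - by move=> e /Hu[eu _]; exists e.
exact: (RHsum_homog _ (RHgV (RHgX N wd))).
Qed.

(** * Contents and products *)

Lemma exists_term (s : seq (G * nat)) (F : G * nat -> K) :
  \sum_(d <- s) F d *: 'X^(d.2) != 0 -> exists2 d, d \in s & F d != 0.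
Proof.
move=> f0; apply: contrapT => no; move/eqP: f0; apply.
rewrite big_seq big1 // => d ds; apply/eqP; rewrite scaler_eq0; apply/orP; left.
by apply: contraT => Fd; case: no; exists d.
Qed.

Lemma Apoly_terms_uniq (s : seq (G * nat)) (F : G * nat -> K) :
  uniq s -> (forall d, RHg d.1 (F d)) ->
  Apoly R Rg (\sum_(d <- s) F d *: 'X^(d.2)) = span R [set y | exists2 d, d \in s & y = F d].
Proof.
move=> us HF; rewrite (@Apoly_terms _ s id) => [|d _]; last exact: HF.
have sR := subring_graded; apply: (span_eq sR) => y.
  move=> [d ->]; have [ds|ds] := boolP (d \in s).
    apply: (span_gen sR); exists d => //.
    by rewrite big_mkcond (bigD1_seq d) //= eqxx big1 ?addr0 // => e /negPf ->.
  rewrite big_seq_cond big1 => [|e /andP[es /eqP ed]].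
    by case: (submodule_span sR [set y | exists2 d, d \in s & y = F d]).
  by rewrite -ed es in ds.
move=> [d ds ->]; apply: (span_gen sR); exists d.
by rewrite big_mkcond (bigD1_seq d) //= eqxx big1 ?addr0 // => e /negPf ->.
Qed.

Lemma submodule_Apoly f : coefs_in (RH R Rg) f -> submodule R (Apoly R Rg f).
Proof.
move=> /poly_RH_terms[s [F [us HF ->]]]; rewrite Apoly_terms_uniq //.
exact: submodule_span subring_graded _.
Qed.

Lemma coef_in_Apoly f i : coefs_in (RH R Rg) f -> Apoly R Rg f f`_i.
Proof.
move=> Hf; have := submodule_Apoly Hf; move: Hf => /poly_RH_terms[s [F [us HF ->]]] sA.
rewrite (coef_terms s id) [X in Apoly _ _ _ X]big_seq_cond.
apply: (submodule_sum (S := R)) => // d /andP[ds _].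
rewrite Apoly_terms_uniq //; apply: (span_gen subring_graded); by exists d.
Qed.

Lemma mul_terms (s t : seq (G * nat)) (F F' : G * nat -> K) :
  (\sum_(d <- s) F d *: 'X^(d.2)) * (\sum_(e <- t) F' e *: 'X^(e.2)) =
  \sum_(p <- [seq (d, e) | d <- s, e <- t]) (F p.1 * F' p.2) *: 'X^((p.1 + p.2).2).
Proof.
rewrite big_allpairs mulr_suml; apply: eq_bigr => d _.
rewrite mulr_sumr; apply: eq_bigr => e _.
by rewrite -scalerAl -scalerAr scalerA -exprD.
Qed.

Lemma Apoly_mul_terms (s t : seq (G * nat)) (F F' : G * nat -> K) :
  (forall d, RHg d.1 (F d)) -> (forall d, RHg d.1 (F' d)) ->
  Apoly R Rg ((\sum_(d <- s) F d *: 'X^(d.2)) * (\sum_(e <- t) F' e *: 'X^(e.2))) =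
  span R [set y | exists d, y = convolution F F' s t d].
Proof.
move=> HF HF'; rewrite mul_terms.
rewrite (@Apoly_terms _ _ (fun p => p.1 + p.2)) => [|p _]; last exact: RHgM.
have E d : \sum_(p <- [seq (d, e) | d <- s, e <- t] | p.1 + p.2 == d) F p.1 * F' p.2 =
    convolution F F' s t d.
  rewrite big_mkcond big_allpairs; apply: eq_bigr => d' _.
  by rewrite [RHS]big_mkcond.
by congr (span R _); apply/seteqP; split=> y [d ->]; exists d; rewrite E.
Qed.

Lemma Apoly_mul_sub f g : coefs_in (RH R Rg) f -> coefs_in (RH R Rg) g ->
  Apoly R Rg (f * g) `<=` modmul R (Apoly R Rg f) (Apoly R Rg g).
Proof.
move=> /poly_RH_terms[s [F [us HF ->]]] /poly_RH_terms[t [F' [ut HF' ->]]].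
rewrite Apoly_mul_terms // !Apoly_terms_uniq //.
have sR := subring_graded; have sM A := submodule_span sR A.
apply: (span_min (sM _)) => _ [d ->]; rewrite /convolution.
rewrite big_seq; apply: (submodule_sum (S := R)) => // d' ds.
rewrite big_seq_cond; apply: (submodule_sum (S := R)) => // e /andP[et _].
by apply: (modmul_gen sR); apply: (span_gen sR); [exists d' | exists e].
Qed.

(** By bilinearity only products of a term of [f] and a term of [g] matter, and for these
    [convolution_integral] applies with indices in [G * nat]. *)
Lemma content_mul_colon f g x : integrally_closed R ->
  coefs_in (RH R Rg) f -> coefs_in (RH R Rg) g -> f != 0 ->
  colon R (Apoly R Rg (f * g)) x -> colon R (modmul R (Apoly R Rg f) (Apoly R Rg g)) x.
Proof.
move=> icR /poly_RH_terms[s [F [us HF ->]]] /poly_RH_terms[t [F' [ut HF' ->]]].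
move=> /exists_term[d0 d0s Fd0].
rewrite Apoly_mul_terms // !Apoly_terms_uniq // => Hx.
have sR := subring_graded; have sRR := submodule_subring sR.
have uG := unique_sums_nat_prod torsion_free_graded.
have H := convolution_integral sR uG icR us ut d0s Fd0
  (fun d => Hx _ (span_gen sR (ex_intro _ d erefl))).
move=> e; apply: (span_min (submodule_preim x sRR)) => _ [z [w [Hz [Hw ->]]]] /=.
move: z Hz; apply: (span_min (M := [set z | R (x * (z * w))])).
  have := submodule_preim (x * w) sRR; congr (submodule R _).
  by apply/seteqP; split=> z /=; rewrite -mulrA [w * z]mulrC.
move=> _ [d ds ->] /=; rewrite mulrA; move: w Hw.
apply: (span_min (submodule_preim (x * F d) sRR)) => _ [e' es ->] /=.
by rewrite -mulrA; apply: H.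
Qed.

(** * Colons, the v-operation and homogeneous scaling *)

Lemma colon_mono (E F : set K) : E `<=` F -> colon R F `<=` colon R E.
Proof. by move=> EF x Fx e /EF; apply: Fx. Qed.

Lemma colon_content_mul f g : integrally_closed R ->
  coefs_in (RH R Rg) f -> coefs_in (RH R Rg) g -> f != 0 ->
  colon R (modmul R (Apoly R Rg f) (Apoly R Rg g)) = colon R (Apoly R Rg (f * g)).
Proof.
move=> icR Hf Hg f0; apply/seteqP; split; last first.
  by move=> x; apply: content_mul_colon.
by apply: colon_mono; apply: Apoly_mul_sub.
Qed.

Lemma submodule_colon (E : set K) : submodule R (colon R E).
Proof.
have sR := subring_graded; split=> [e _|x y Ex Ey e Ee|r x Rr Ex e Ee].
- by rewrite mul0r; apply: (subring0 sR).
- by rewrite mulrDl; apply: (subringD sR); [apply: Ex | apply: Ey].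
- by rewrite -mulrA; apply: (subringM sR) => //; apply: Ex.
Qed.

Lemma sub_vop (E : set K) : E `<=` vop R E.
Proof. by move=> x Ex y /(_ x Ex); rewrite mulrC. Qed.

Lemma semistar_vop : semistar R (vop R).
Proof.
split.
  move=> E [E0 [ED [EZ [x [Ex x0]]]]]; have [V0 VD VZ] := submodule_colon (colon R E).
  by do !split=> //; exists x; split=> //; apply: sub_vop.
split.
  move=> x E x0 _; apply/seteqP; split=> y.
    move=> Hy; exists (y / x); last by rewrite mulrC divfK.
    move=> z Hz; rewrite -mulrA; apply: Hy => _ [e Ee ->].
    by have -> : x^-1 * z * (x * e) = z * e; [field | apply: Hz].
  move=> [z Hz ->] w Hw; rewrite [x * z]mulrC -mulrA; apply: Hz => e Ee.
  by rewrite mulrAC mulrC; apply: Hw; exists e.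
split; first by move=> E F _ _ EF; apply: colon_mono; apply: colon_mono.
split; first by move=> E _; apply: sub_vop.
(* Of the four nested colons one is stripped; what remains is that three colons equal one. *)
move=> E _; congr (colon R _); apply/seteqP; split; last exact: sub_vop.
by apply: colon_mono; apply: sub_vop.
Qed.

Lemma vop_graded : vop R R = R.
Proof.
have sR := subring_graded; apply/seteqP; split; last exact: sub_vop.
move=> x Hx; rewrite -[x]mulr1; apply: Hx => r Rr; by rewrite mul1r.
Qed.

(** Multiplication by a homogeneous [c] merely shifts degrees, so each component of [c x] is [c]
    times a component of [x]. *)
Lemma hcomp_scaled b c x : RHg b c -> R x -> hcomp Rg (c * x) `<=` scale c R.
Proof.
move=> bc /component_dec[s [C [RC ->]]] y; rewrite mulr_sumr.
rewrite (@hcompE _ s (fun a => b + a) (fun a => c * C a)) => [|a _]; last first.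
  by apply: RHgM => //; apply: RHg_component.
move=> [a ->]; rewrite -mulr_sumr; exists (\sum_(d <- s | b + d == a) C d) => //.
apply: (subring_sum subring_graded) => d _ _; exact: component_sub (RC d).
Qed.

Lemma Apoly_scaled b c p : RHg b c -> coefs_in R p -> Apoly R Rg (c *: p) `<=` scale c R.
Proof.
have sR := subring_graded => bc Rp.
have sS : submodule R (scale c R).
  split; first by exists 0; [apply: (subring0 sR) | rewrite mulr0].
  - move=> _ _ [u Ru ->] [v Rv ->]; exists (u + v); last by rewrite mulrDr.
    exact: (subringD sR).
  - move=> r _ Rr [u Ru ->]; exists (r * u); last by rewrite mulrCA.
    exact: (subringM sR).
move=> _ [e [He ->]]; apply: (submodule_sum (S := R)) => // i _.
have := He i; apply: (span_min sS); rewrite coefZ.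
by apply: (hcomp_scaled bc).
Qed.

Lemma Apoly_sub p : coefs_in R p -> Apoly R Rg p `<=` R.
Proof.
move=> Rp z; rewrite -[p]scale1r => /(Apoly_scaled RHg1 Rp)[r Rr ->].
by rewrite mul1r.
Qed.

Lemma coefs_in_RH p : coefs_in R p -> coefs_in (RH R Rg) p.
Proof. by move=> Rp i; apply: sub_RH. Qed.

Lemma nonzero_Apoly f : coefs_in (RH R Rg) f -> f != 0 -> nonzero_submodule R (Apoly R Rg f).
Proof.
move=> Hf f0; have [A0 AD AZ] := submodule_Apoly Hf.
do !split=> //; exists (lead_coef f); rewrite lead_coef_eq0; split=> //.
exact: coef_in_Apoly.
Qed.

Lemma nonzero_modmul (A B : set K) : nonzero_submodule R A -> nonzero_submodule R B ->
  nonzero_submodule R (modmul R A B).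
Proof.
move=> [_ [_ [_ [a [Aa a0]]]]] [_ [_ [_ [b [Bb b0]]]]].
have sR := subring_graded.
have [M0 MD MZ] := submodule_span sR [set z | exists a b, A a /\ B b /\ z = a * b].
do !split=> //; exists (a * b); split; last exact: mulf_neq0.
exact: (modmul_gen sR).
Qed.

Lemma nonzero_graded : nonzero_submodule R R.
Proof.
have sR := subring_graded; have [R0 RD RZ] := submodule_subring sR.
by do !split=> //; exists 1; split; [apply: (subring1 sR) | apply: oner_neq0].
Qed.

(** * From content conditions to integral closedness, and the divisor condition *)

Lemma coefs_in_quotient (S : set K) (x : K) (q : {poly K}) : subring S -> S x ->
  coefs_in S (q * ('X - x%:P)) -> coefs_in S q.
Proof.
move=> sS Sx Sp i; have [k] := ubnP (size q - i); elim: k i => // k IHk i ki.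
have [le_i|lt_i] := leqP (size q) i; first by rewrite nth_default //; apply: (subring0 sS).
(* Synthetic division from the top: each coefficient of [q] comes from the next one, and those
   beyond the size vanish. *)
have -> : q`_i = (q * ('X - x%:P))`_i.+1 + q`_i.+1 * x.
  by rewrite mulrBr coefB coefMX coefMC /= subrK.
apply: (subringD sS) => //; apply: (subringM sS) => //; apply: IHk.
by rewrite subnS -ltnS prednK // subn_gt0.
Qed.

Lemma integral_factor x :
  (exists p : {poly K}, p \is monic /\ coefs_in R p /\ root p x) ->
  exists q, [/\ RH R Rg x, q \is monic, coefs_in (RH R Rg) q &
    coefs_in R (('X - x%:P) * q)].
Proof.
move=> [p [mp [Rp px]]]; have xRH : RH R Rg x.
  by apply: integrally_closed_RH; exists p; split=> //; split=> //; apply: coefs_in_RH.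
have /factor_theorem[q pE] := px; exists q; split=> //.
- by move: mp; rewrite pE monicMr // monicXsubC.
- by apply: (coefs_in_quotient subring_RH xRH); rewrite -pE; apply: coefs_in_RH.
- by rewrite mulrC -pE.
Qed.

Lemma poly_common_denominator q : coefs_in (RH R Rg) q ->
  exists2 h, homog Rg h & coefs_in R (h *: q).
Proof.
move=> /poly_RH_terms[s [F [us HF ->]]].
have [|b [h [bh h0 H]]] := @common_denominator _ s fst F; first by move=> d _; apply: HF.
exists h; first by split=> //; exists b.
move=> i; rewrite coefZ (coef_terms s id) mulr_sumr.
apply: (subring_sum subring_graded) => d ds _; rewrite mulrC.
exact: component_sub (H d ds).
Qed.

Lemma homog_sub : homog Rg `<=` R.
Proof. by move=> h [_ [b /component_sub]]. Qed.

Lemma linear_clear x : RH R Rg x -> exists h, [/\ homog Rg h, R (h * x) &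
  coefs_in R (h *: ('X - x%:P))].
Proof.
move=> [a [h [Ra [Hh ->]]]]; exists h.
have hx : h * (a / h) = a by rewrite mulrC divfK //; case: Hh.
have sR := subring_graded; rewrite hx scalerBr scale_polyC hx; split=> //.
apply: (coefs_inB sR); last exact: (coefs_inC sR).
by apply: (coefs_inZ sR); [apply: homog_sub | apply: (coefs_inX sR)].
Qed.

Lemma linear_coef0 (h x : K) : (h *: ('X - x%:P))`_0 = - (h * x).
Proof. by rewrite coefZ coefB coefX coefC /= sub0r mulrN. Qed.

(** Take [f = h (X - x)] and [g = h' q]. The product [- h x h'] of coefficients lies in [A_f A_g],
    while [A_(fg)] is contained in [h h' R]. *)
Lemma vop_mul_integrally_closed :
  (forall f g : {poly K}, coefs_in R f -> coefs_in R g -> f != 0 -> g != 0 ->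
     vop R (modmul R (Apoly R Rg f) (Apoly R Rg g)) = vop R (Apoly R Rg (f * g))) ->
  integrally_closed R.
Proof.
move=> H x /integral_factor[q [xRH mq Hq Rp]].
have sR := subring_graded.
have [h [Hh Rhx Rf]] := linear_clear xRH.
have [h' Hh' Rg'] := poly_common_denominator Hq.
have [h0 [b bh]] := Hh; have [h'0 [b' bh']] := Hh'.
have f0 : h *: ('X - x%:P) != 0 by rewrite scaler_eq0 negb_or h0 polyXsubC_eq0.
have g0 : h' *: q != 0 by rewrite scaler_eq0 negb_or h'0 monic_neq0.
have := H _ _ Rf Rg' f0 g0; rewrite -scalerAl -scalerAr scalerA => vE.
have hh : RHg (b + b') (h * h') by apply: RHgM; apply: RHg_component.
have : vop R (Apoly R Rg ((h * h') *: (('X - x%:P) * q))) (- (h * x) * h').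
  rewrite -vE; apply: sub_vop; apply: (modmul_gen sR).
    rewrite -linear_coef0; apply: coef_in_Apoly; exact: coefs_in_RH.
  have := coef_in_Apoly (size q).-1 (coefs_in_RH Rg').
  by rewrite coefZ -lead_coefE (monicP mq) mulr1.
(* This scalar lies in [(R : A_(fg))], and its sign turns the product into [x] itself. *)
move=> /(_ (- (h * h')^-1)).
have -> : - (h * x) * h' * - (h * h')^-1 = x by field; rewrite h0 h'0.
apply=> e /(Apoly_scaled hh Rp)[r Rr ->].
by rewrite mulNr mulKf ?mulf_neq0 //; apply: (subringN sR).
Qed.

(** Here [X - x] is itself admissible. Its coefficient [- x] times the leading coefficient 1 of [q]
    lies in [A_f A_g], and the closure of [A_(fg)] stays in [R] because [star R = R]. *)
Lemma star_mul_integrally_closed (star : set K -> set K) :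
  semistar R star -> star R = R ->
  (forall f g : {poly K}, coefs_in (RH R Rg) f -> coefs_in (RH R Rg) g ->
     f != 0 -> g != 0 -> size f = 2%N ->
     star (modmul R (Apoly R Rg f) (Apoly R Rg g)) = star (Apoly R Rg (f * g))) ->
  integrally_closed R.
Proof.
move=> [_ [_ [star_mono [star_ext _]]]] starR H x /integral_factor[q [xRH mq Hq Rp]].
have sR := subring_graded; have sRH := subring_RH.
have Hf : coefs_in (RH R Rg) ('X - x%:P).
  by apply: (coefs_inB sRH); [apply: (coefs_inX sRH) | apply: (coefs_inC sRH)].
have f0 : 'X - x%:P != 0 by rewrite polyXsubC_eq0.
have q0 := monic_neq0 mq.
have nA := nonzero_Apoly Hf f0; have nB := nonzero_Apoly Hq q0.
have nP := nonzero_Apoly (coefs_in_RH Rp) (mulf_neq0 f0 q0).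
have sub : star (Apoly R Rg (('X - x%:P) * q)) `<=` R.
  by rewrite -{2}starR; apply: star_mono => //; [apply: nonzero_graded | apply: Apoly_sub].
rewrite -[x]opprK; apply: (subringN sR); apply: sub.
rewrite -(H _ _ Hf Hq f0 q0 (size_XsubC x)); apply: star_ext; first exact: nonzero_modmul.
rewrite -[- x]mulr1; apply: (modmul_gen sR).
  have <- : ('X - x%:P)`_0 = - x by rewrite coefB coefX coefC sub0r.
  exact: coef_in_Apoly.
by rewrite -(monicP mq); apply: coef_in_Apoly.
Qed.

(** With [f = h (X - x)], the monic multiple [(X - x) q] equals [f (h^-1 q)]. The condition puts the
    leading coefficient [h^-1] into [(R : A_f)], and multiplying it by the coefficient [- h x] of
    [f] gives [- x]. *)
Lemma divisor_integrally_closed :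
  (forall f : {poly K}, coefs_in R f -> f != 0 ->
     [set p | (exists2 q, coefs_in (RH R Rg) q & p = f * q) /\ coefs_in R p] =
     [set p | exists (n : nat) (c : 'I_n -> K) (q : 'I_n -> {poly K}),
        (forall i, colon R (Apoly R Rg f) (c i)) /\ (forall i, coefs_in R (q i)) /\
        p = f * \sum_(i < n) (c i)%:P * q i]) ->
  integrally_closed R.
Proof.
move=> H x /integral_factor[q [xRH mq Hq Rp]].
have sR := subring_graded.
have [h [Hh Rhx Rf]] := linear_clear xRH; have [h0 [b bh]] := Hh.
have f0 : h *: ('X - x%:P) != 0 by rewrite scaler_eq0 negb_or h0 polyXsubC_eq0.
have pE : ('X - x%:P) * q = h *: ('X - x%:P) * (h^-1 *: q).
  by rewrite -scalerAl -scalerAr scalerA divff // scale1r.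
have := H _ Rf f0; set L := [set p | _ /\ _] => LE.
have : L (('X - x%:P) * q).
  split=> //; exists (h^-1 *: q) => //; apply: (coefs_inZ subring_RH) => //.
  rewrite RHsumT; apply: (@RHsum_homog _ (- b)) => //.
  by apply/RHgV/RHg_component.
rewrite LE pE => -[n [c [u [Hc [Ru]]]]] /(mulfI f0) e.
have : colon R (Apoly R Rg (h *: ('X - x%:P))) h^-1.
  have <- : (h^-1 *: q)`_(size q).-1 = h^-1.
    by rewrite coefZ -lead_coefE (monicP mq) mulr1.
  rewrite e coef_sum.
  apply: (submodule_sum (S := R)) => [|i _]; first exact: submodule_colon.
  rewrite coefCM mulrC; case: (submodule_colon (Apoly R Rg (h *: ('X - x%:P)))) => _ _.
  by apply; [apply: Ru | apply: Hc].
move=> /(_ _ (coef_in_Apoly 0 (coefs_in_RH Rf))); rewrite linear_coef0 mulrN mulKf //.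
by move/(subringN sR); rewrite opprK.
Qed.

Lemma integrally_closed_divisor f : integrally_closed R -> coefs_in R f -> f != 0 ->
  [set p | (exists2 q, coefs_in (RH R Rg) q & p = f * q) /\ coefs_in R p] =
  [set p | exists (n : nat) (c : 'I_n -> K) (q : 'I_n -> {poly K}),
     (forall i, colon R (Apoly R Rg f) (c i)) /\ (forall i, coefs_in R (q i)) /\
     p = f * \sum_(i < n) (c i)%:P * q i].
Proof.
move=> icR Rf f0; have sR := subring_graded; have Hf := coefs_in_RH Rf.
apply/seteqP; split=> p.
  move=> [[q Hq ->] Rp]; exists (size q), (fun i => q`_i), (fun i => 'X^i).
  split; last split=> [i|].
  - move=> i e Ae.
    (* That [f q] has coefficients in [R] means that 1 lies in [(R : A_(fq))]; hence [A_f A_q] is in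
       [R], and each coefficient of [q] lies in [(R : A_f)]. *)
    have /(content_mul_colon icR Hf Hq f0) : colon R (Apoly R Rg (f * q)) 1.
      by move=> z /(Apoly_sub Rp); rewrite mul1r.
    move/(_ (e * q`_i)); rewrite mul1r => fq; rewrite mulrC; apply: fq.
    by apply: (modmul_gen sR) => //; apply: coef_in_Apoly.
  - exact: (coefs_inXn sR).
  - congr (_ * _); rewrite -{1}[q]coefK poly_def; apply: eq_bigr => i _.
    by rewrite mul_polyC.
move=> [n [c [q [Hc [Rq ->]]]]].
(* Some term [F d] of [f] is nonzero and homogeneous, so [c i] is the element [c i * F d] of [R]
   divided by a unit of [R_H]. *)
have cRH i : RH R Rg (c i).
  have := Hc i; move: (c i) f0; have [s [F [us HF ->]]] := poly_RH_terms Hf.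
  rewrite Apoly_terms_uniq // => x /exists_term[d ds Fd] Hx.
  rewrite -[x](mulfK Fd); apply: (subringM subring_RH).
    apply: sub_RH; apply: Hx; apply: (span_gen sR); by exists d.
  by rewrite RHsumT; apply: (RHsum_homog _ (RHgV (HF d))).
split.
  exists (\sum_(i < n) (c i)%:P * q i) => //.
  apply: (big_ind (coefs_in (RH R Rg))) => [||i _].
  - by apply: (coefs_inC subring_RH); apply: (subring0 subring_RH).
  - exact: (coefs_inD subring_RH).
  - by apply: (coefs_inM subring_RH); [apply: (coefs_inC subring_RH) | apply: coefs_in_RH].
rewrite mulr_sumr; apply: (big_ind (coefs_in R)) => [||i _].
- by apply: (coefs_inC sR); apply: (subring0 sR).
- exact: (coefs_inD sR).
rewrite mulrA; apply: (coefs_inM sR) => // j.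
by rewrite coefMC mulrC; apply: Hc; apply: coef_in_Apoly.
Qed.

End GradedDomain.

Theorem theorem3p3 (K : fieldType) (G : zmodType) (Gam : set G) (R : set K)
    (Rg : G -> set K) :
  graded_domain Gam R Rg ->
  [<-> integrally_closed R;
       forall f g : {poly K}, coefs_in R f -> coefs_in R g -> f != 0 -> g != 0 ->
         vop R (modmul R (Apoly R Rg f) (Apoly R Rg g)) = vop R (Apoly R Rg (f * g));
       exists star : set K -> set K,
         semistar R star /\ star R = R /\
         forall f g : {poly K}, coefs_in (RH R Rg) f -> coefs_in (RH R Rg) g ->
           f != 0 -> g != 0 -> size f = 2%N ->
           star (modmul R (Apoly R Rg f) (Apoly R Rg g)) = star (Apoly R Rg (f * g));
       forall f : {poly K}, coefs_in R f -> f != 0 ->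
         [set p | (exists2 q, coefs_in (RH R Rg) q & p = f * q) /\ coefs_in R p] =
         [set p | exists (n : nat) (c : 'I_n -> K) (q : 'I_n -> {poly K}),
            (forall i, colon R (Apoly R Rg f) (c i)) /\ (forall i, coefs_in R (q i)) /\
            p = f * \sum_(i < n) (c i)%:P * q i]].
Proof.
move=> gr; tfae.
- move=> icR f g Rf RFg f0 _; congr (colon R _).
  by apply: (colon_content_mul gr) => //; apply: (coefs_in_RH gr).
(* Condition (2) speaks of [R[X]] only, whereas (3) concerns [R_H[X]]; the passage goes through
   integral closedness. *)
- move=> /(vop_mul_integrally_closed gr) icR; exists (vop R).
  split; first exact: (semistar_vop gr).
  split; first exact: (vop_graded gr).
  move=> f g Hf Hg f0 _ _; congr (colon R _).
  exact: (colon_content_mul gr).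
- move=> [star [star_semi [starR H]]] f Rf f0.
  apply: (integrally_closed_divisor gr) => //.
  exact: (star_mul_integrally_closed gr star_semi starR H).
- exact: (divisor_integrally_closed gr).
Qed.
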